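(* Let $(X,d)$ be an unbounded, locally complete and incomplete metric space, and let $\widetilde j$ be the metric on $X$ $$\widetilde j(x,y)=\frac12\log\left[\left(1+\frac{d(x,y)}{d(x)}\right)\left(1+\frac{d(x,y)}{d(y)}\right)\right]\qquad(x,y\in X).$$ Then $(X,\widetilde j)$ is Gromov hyperbolic, and there is a natural map $\widetilde\varphi\colon\partial_{\widetilde j}X\to\partial X\cup\{\infty\}$ and a point $\xi\in\partial_{\widetilde j}X$ with $\widetilde\varphi(\xi)=\infty$ such that, for every Busemann function $b\in\mathcal B_{\widetilde j}(\xi)$ and every Hamenstädt metric $\widetilde j_{b,\varepsilon}$ on $\partial_{\widetilde j}X\setminus\{\xi\}$ based at $b$ with (admissible) parameter $\varepsilon$, the map $$\widetilde\varphi\colon(\partial_{\widetilde j}X\setminus\{\xi\},\widetilde j_{b,\varepsilon})\to(\partial X,d)$$ is $\widetilde\eta$-quasisymmetric, where the function $\widetilde\eta$ depends only on $\varepsilon$.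
   Context: **Metric boundary.** For a metric space $(X,d)$, $\overline X$ is its metric completion, $\partial X=\overline X\setminus X$ (with the metric $d$ extended to $\overline X$). $X$ is incomplete if $\partial X\ne\emptyset$, and locally complete if every point has a complete neighbourhood. For $x\in X$, $d(x):=d(x,\partial X)$ is the distance from $x$ to $\partial X$; it is positive when $X$ is locally complete and incomplete. **Gromov hyperbolicity.** For a metric space $(X,m)$, $(x|y)_w=\frac12[m(x,w)+m(y,w)-m(x,y)]$. $(X,m)$ is $\delta$-hyperbolic if $(x|y)_w\ge\min\{(x|z)_w,(z|y)_w\}-\delta$ for all $x,y,z,w\in X$, and Gromov hyperbolic if this holds for some $\delta\ge0$. A sequence $\{x_i\}$ is a Gromov sequence if $(x_i|x_j)_w\to\infty$ as $i,j\to\infty$; Gromov sequences $\{x_i\},\{y_i\}$ are equivalent if $(x_i|y_i)_w\to\infty$. The Gromov boundary ($\partial_\infty X$, or $\partial_mX$ to indicate the metric $m$) is the set of equivalence classes. For $x\in X$, $\xi,\zeta\in\partial_mX$: $(x|\xi)_w=\inf\{\liminf_i(x|y_i)_w:\{y_i\}\in\xi\}$ and $(\xi|\zeta)_w=\inf\{\liminf_i(x_i|y_i)_w:\{x_i\}\in\xi,\{y_i\}\in\zeta\}$. **Busemann functions and Hamenstädt metrics.** Let $(X,m)$ be $\delta$-hyperbolic and $\xi\in\partial_mX$. A Busemann function based at $\xi$ is a function $b=b_{\xi,w}\colon X\to\mathbb R$, $b(x)=(\xi|w)_x-(\xi|x)_w$, for some $w\in X$; the set of these is $\mathcal B_m(\xi)$.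 Put $(x|y)_b=\frac12(b(x)+b(y)-m(x,y))$ for $x,y\in X$, and for $\xi_1,\xi_2\in\partial_mX\setminus\{\xi\}$, $(\xi_1|\xi_2)_b=\inf\{\liminf_i(x_i|y_i)_b:\{x_i\}\in\xi_1,\{y_i\}\in\xi_2\}$. A parameter $\varepsilon>0$ is admissible if $e^{22\varepsilon\delta}\le2$. For admissible $\varepsilon$ let $\rho_{b,\varepsilon}(\xi_1,\xi_2)=e^{-\varepsilon(\xi_1|\xi_2)_b}$ (with $e^{-\infty}=0$). The Hamenstädt metric based at $b$ with parameter $\varepsilon$ on $\partial_mX\setminus\{\xi\}$, denoted $m_{b,\varepsilon}$, is $m_{b,\varepsilon}(\xi_1,\xi_2)=\inf\sum_{i=1}^n\rho_{b,\varepsilon}(\zeta_{i-1},\zeta_i)$, the infimum over all $n\ge1$ and all chains $\xi_1=\zeta_0,\dots,\zeta_n=\xi_2$ in $\partial_mX\setminus\{\xi\}$. It is a metric with $\frac12\rho_{b,\varepsilon}\le m_{b,\varepsilon}\le\rho_{b,\varepsilon}$. **Natural maps.** For unbounded $X$, equip $\overline X\cup\{\infty\}$ with the topology whose open sets are the open sets of $\overline X$ and the sets $U\ni\infty$ whose complement is a closed bounded subset of $\overline X$. If $m$ is a metric on $X$ with $(X,m)$ Gromov hyperbolic, a map $\psi\colon\partial_mX\to\partial X\cup\{\infty\}$ is natural if it is a continuous extension of the identity map $(X,m)\to(X,d)$, i.e. the identity together with $\psi$ is continuous from $X\cup\partial_mX$ to $\overline X\cup\{\infty\}$. Here $X\cup\partial_mX$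 has its usual topology: $X$ is open with the $m$-topology, and the sets $\{z:(z|\zeta)_w>t\}$, $t>0$, form a neighbourhood base at $\zeta\in\partial_mX$. In particular $x_i\to\psi(\zeta)$ for every Gromov sequence $\{x_i\}\in\zeta$. **Quasisymmetry.** A homeomorphism $f\colon(Y,\sigma)\to(Y',\sigma')$ is $\eta$-quasisymmetric, for a homeomorphism $\eta\colon[0,\infty)\to[0,\infty)$, if $\sigma(x,y)\le t\,\sigma(x,z)$ implies $\sigma'(f(x),f(y))\le\eta(t)\,\sigma'(f(x),f(z))$ for all $t>0$ and $x,y,z\in Y$. *)

(* Defs.v *)
From HB Require Import structures.
From mathcomp Require Import all_boot all_order all_algebra.
From mathcomp Require Import all_classical all_reals all_analysis.
From mathcomp Require Import ring lra.
Import Order.TTheory GRing.Theory Num.Theory.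
Import numFieldNormedType.Exports.

Set Implicit Arguments.
Unset Strict Implicit.
Unset Printing Implicit Defensive.

Local Open Scope classical_set_scope.
Local Open Scope ring_scope.

Section MetricSpaces.
Context {R : realType}.

Definition complete_set (X : metricType R) (A : set X) : Prop :=
  forall u : nat -> X, (forall n, A (u n)) -> cauchy (u @ \oo) ->
    exists2 l, A l & u @ \oo --> l.

Definition locally_complete (X : metricType R) : Prop :=
  forall x : X, exists2 U : set X, nbhs x U & complete_set U.

Definition metric_bounded (X : metricType R) (A : set X) : Prop :=
  exists M : R, forall x y, A x -> A y -> mdist x y <= M.

(* The metric completion is only determined up to an isometry over X, so it is
   handled through its characterization. See [completion_exists] below. *)
Record completion (X : metricType R) := Completion {
  completion_carrier :> metricType R;
  to_completion : X -> completion_carrier;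
  to_completion_isometry : forall x y,
    mdist (to_completion x) (to_completion y) = mdist x y;
  to_completion_dense : closure (range to_completion) = setT;
  completion_complete : complete_set [set: completion_carrier]
}.

Arguments to_completion {X} C x : rename.

Definition metric_boundary (X : metricType R) (C : completion X) : set C :=
  ~` range (to_completion C).

Arguments metric_boundary {X} C _.

Definition boundary_dist (X : metricType R) (C : completion X) (x : X) : R :=
  inf [set mdist (to_completion C x) p | p in metric_boundary C].

Definition jtilde (X : metricType R) (C : completion X) (x y : X) : R :=
  2^-1 * ln ((1 + mdist x y / boundary_dist C x) *
             (1 + mdist x y / boundary_dist C y)).

End MetricSpaces.

Arguments to_completion {R X} C x : rename.
Arguments metric_boundary {R X} C _.

Section CompletionExists.
Context {R : realType} (X : metricType R).

(* Kuratowski embedding: a point of the completion is represented by its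
   distance function to the points of X, with the sup metric. *)
Let kur : set (X -> R) := [set f | forall e, 0 < e ->
  exists x : X, forall y, `|f y - mdist x y| <= e].

Definition kuratowski : Type := kur.
HB.instance Definition _ := Choice.on kuratowski.

Let kd (f g : X -> R) : R := sup (range (fun y => `|f y - g y|)).

Let kur_ub f g : kur f -> kur g -> has_ubound (range (fun y => `|f y - g y|)).
Proof.
move=> /(_ 1 ltr01)[x fx] /(_ 1 ltr01)[x' gx].
exists (1 + mdist x x' + 1) => _ [y _ <-].
have -> : f y - g y = (f y - mdist x y) + ((mdist x y - mdist x' y)
  - (g y - mdist x' y)) by ring.
rewrite (le_trans (ler_normD _ _))// -[leRHS]addrA lerD ?fx//.
rewrite (le_trans (ler_normB _ _))// lerD ?gx//.
have /= h1 := metric_triangle x x' y; have /= h2 := metric_triangle x' x y.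
rewrite (metric_sym x' x) in h2.
by rewrite ler_norml; apply/andP; split; lra.
Qed.

Let kd_ge f g y : kur f -> kur g -> `|f y - g y| <= kd f g.
Proof. by move=> kf kg; apply: ub_le_sup; [exact: kur_ub|exists y]. Qed.

Let kd_le f g M : kur f -> (forall y, `|f y - g y| <= M) -> kd f g <= M.
Proof.
move=> kf h; have [x _] := kf 1 ltr01.
by apply: ge_sup; [exists `|f x - g x|, x|move=> _ [y _ <-]].
Qed.

Let kdist (f g : kuratowski) : R := kd (val f) (val g).

Let kP (f : kuratowski) : kur (val f). Proof. exact: set_valP. Qed.

Let kdistxx f : kdist f f = 0.
Proof.
have [x _] := kP f ltr01.
apply/le_anti/andP; split.
  by apply: kd_le => // y; rewrite subrr normr0.
exact: (le_trans (normr_ge0 _) (kd_ge x (kP f) (kP f))).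
Qed.

Let kdist_positivity f g : kdist f g = 0 -> f = g.
Proof.
move=> fg; apply: val_inj; apply/funext => y; apply/eqP.
rewrite -subr_eq0 -normr_eq0; apply/eqP/le_anti/andP; split=> //.
by rewrite -fg; exact: kd_ge.
Qed.

Let kdist_sym f g : kdist f g = kdist g f.
Proof.
rewrite /kdist /kd; suff -> : (fun y => `|val f y - val g y|) =
  (fun y => `|val g y - val f y|) by [].
by apply/funext => y; rewrite distrC.
Qed.

Let kdist_triangle g f h : kdist f h <= kdist f g + kdist g h.
Proof.
apply: kd_le => // y; rewrite (le_trans (ler_distD (val g y) _ _))//.
by apply: lerD; exact: kd_ge.
Qed.

HB.instance Definition _ := @isMetric.Build R kuratowski kdist
  kdistxx kdist_positivity kdist_sym kdist_triangle.

Let kemb_subproof (x : X) : mdist x \in kur.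
Proof. by apply/mem_set => e e0; exists x => y; rewrite subrr normr0 ltW. Qed.

Let kemb (x : X) : kuratowski := SigSub (kemb_subproof x).

Let kemb_isometry x y : mdist (kemb x) (kemb y) = mdist x y.
Proof.
apply/le_anti/andP; split.
  apply: kd_le => [|z]/=; first exact: (kP (kemb x)).
  have /= h1 := metric_triangle x y z; have /= h2 := metric_triangle y x z.
  rewrite (metric_sym y x) in h2.
  by rewrite ler_norml; apply/andP; split; lra.
have := kd_ge y (kP (kemb x)) (kP (kemb y)).
by rewrite /= mdistxx subr0 ger0_norm ?mdist_ge0.
Qed.

Let kemb_near (f : kuratowski) e : 0 < e -> exists x, mdist f (kemb x) <= e.
Proof. by move=> /(kP f)[x fx]; exists x; exact: kd_le. Qed.

Let kemb_dense : closure (range kemb) = setT.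
Proof.
apply/seteqP; split=> // f _ B /nbhs_ballP[e /= e0 eB].
have [x fx] := kemb_near f (divr_gt0 e0 (ltr0n R 2)).
exists (kemb x); split; first by exists x.
by apply: eB; rewrite ballEmdist/= (le_lt_trans fx)// ltr_pdivrMr// ltr_pMr// ltr1n.
Qed.

Let kuratowski_complete : complete_set [set: kuratowski].
Proof.
move=> u _ /cauchy_ballP cu.
have cu' e : 0 < e -> exists N : nat, forall m n, (N <= m)%N -> (N <= n)%N ->
    mdist (u m) (u n) < e.
  move=> /cu[[P Q] /= [[N1 _ PN1] [N2 _ QN2]] sub].
  exists (maxn N1 N2) => m n; rewrite !geq_max => /andP[m1 _] /andP[_ n2].
  by have := sub (u m, u n) (conj (PN1 _ m1) (QN2 _ n2)); rewrite ballEmdist.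
have ku m n y : `|val (u m) y - val (u n) y| <= mdist (u m) (u n).
  exact: kd_ge.
have cy y : cvgn (fun n => val (u n) y).
  apply/cauchy_cvgP/cauchy_ballP => e e0; have [N uN] := cu' _ e0.
  exists ([set x | exists2 n, (N <= n)%N & x = val (u n) y],
          [set x | exists2 n, (N <= n)%N & x = val (u n) y]).
    by split; exists N => // n /= Nn; exists n.
  move=> [_ _] /= [[m Nm ->] [n Nn ->]].
  by rewrite /ball/= (le_lt_trans (ku _ _ _))// uN.
pose g y : R := limn (fun n => val (u n) y).
have gu e : 0 < e -> exists N : nat, forall n, (N <= n)%N ->
    forall y, `|val (u n) y - g y| <= e.
  move=> e0; have [N uN] := cu' _ e0; exists N => n Nn y.
  have : (fun m => `|val (u n) y - val (u m) y|) @ \oo --> `|val (u n) y - g y|.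
    by apply: cvg_norm; apply: cvgB; [exact: cvg_cst|exact: cy].
  move=> /cvg_lim <- //; apply: limr_le.
    by apply/cvg_ex; exists `|val (u n) y - g y|;
       apply: cvg_norm; apply: cvgB; [exact: cvg_cst|exact: cy].
  by exists N => // m /= Nm; rewrite (le_trans (ku _ _ _))// ltW// uN.
have kg : g \in kur.
  apply/mem_set => e e0; have e2 : 0 < e / 2 by rewrite divr_gt0.
  have [N uN] := gu _ e2; have [x ux] := kP (u N) e2; exists x => y.
  have -> : g y - mdist x y = (val (u N) y - mdist x y) - (val (u N) y - g y).
    by ring.
  rewrite (le_trans (ler_normB _ _))// [leRHS]splitr lerD//.
  exact: uN.
exists (SigSub kg) => //; apply/cvg_ballP => e e0.
have e2 : 0 < e / 2 by rewrite divr_gt0.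
have [N uN] := gu _ e2; exists N => // n /= Nn; rewrite ballEmdist/= metric_sym.
rewrite (@le_lt_trans _ _ (e / 2))//; last by rewrite ltr_pdivrMr// ltr_pMr// ltr1n.
by apply: kd_le => // y; exact: uN.
Qed.

Lemma completion_exists : inhabited (completion X).
Proof. by split; exact: (Completion kemb_isometry kemb_dense). Qed.

End CompletionExists.

Section JtildeMetric.
Context {R : realType} (X : metricType R) (C : completion X).
Hypotheses (lc : locally_complete X) (inc : metric_boundary C !=set0).

Let bd_has_inf (x : X) :
  has_inf [set mdist (to_completion C x) p | p in metric_boundary C].
Proof.
have [p pb] := inc; split; first by exists (mdist (to_completion C x) p), p.
by exists 0 => _ [q _ <-]; exact: mdist_ge0.
Qed.

Lemma boundary_dist_gt0 (x : X) : 0 < boundary_dist C x.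
Proof.
have [U /nbhs_ballP[r /= r0 rU] cU] := lc x.
apply: (lt_le_trans r0); have [ne _] := bd_has_inf x.
apply: lb_le_inf => // _ [p pb <-]; rewrite leNgt; apply/negP => pr.
have pc : closure (range (to_completion C)) p by rewrite to_completion_dense.
pose s n : R := Num.min n.+1%:R^-1 (r - mdist (to_completion C x) p).
have s0 n : 0 < s n by rewrite lt_min invr_gt0 ltr0n subr_gt0.
have /choice[u us] n : exists y, mdist p (to_completion C y) < s n.
  have [_ [[y _ <-]]] := pc _ (nbhsx_ballx p _ (s0 n)).
  by rewrite ballEmdist => ?; exists y.
have uU n : U (u n).
  apply: rU; rewrite ballEmdist/= -(to_completion_isometry C).
  rewrite (le_lt_trans (metric_triangle _ p _))//.
  by have := us n; rewrite lt_min => /andP[_]; rewrite ltrBrDl.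
have up : to_completion C \o u @ \oo --> p.
  apply/cvg_ballP => e e0; near=> n; rewrite ballEmdist/=.
  apply: lt_trans (us n) _; rewrite gt_min; apply/orP; left.
  by near: n; exact: near_infty_natSinv_lt (PosNum e0).
have uc : cauchy (u @ \oo).
  apply/cauchy_ballP => e e0; have e2 : 0 < e / 2 by rewrite divr_gt0.
  have /cvg_ballP/(_ _ e2)[N _ uN] := up.
  exists (u @` [set n | (N <= n)%N], u @` [set n | (N <= n)%N]).
    by split; exists N => // n Nn /=; exists n.
  move=> [_ _] /= [[m Nm <-] [n Nn <-]].
  rewrite ballEmdist/= -(to_completion_isometry C).
  rewrite (le_lt_trans (metric_triangle _ p _))// [ltRHS]splitr ltrD//.
    by have := uN _ Nm; rewrite ballEmdist/= metric_sym.
  by have := uN _ Nn; rewrite ballEmdist.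
have [l _ ul] := cU u uU uc.
have ul' : to_completion C \o u @ \oo --> to_completion C l.
  apply/cvg_ballP => e e0; have /cvg_ballP/(_ _ e0) := ul.
  by apply: filterS => n; rewrite !ballEmdist/= to_completion_isometry.
apply: pb; exists l => //.
exact: (cvg_unique (@metric_hausdorff R C) ul' up).
Unshelve. all: by end_near. Qed.

Lemma boundary_dist_le (x y : X) :
  boundary_dist C x <= boundary_dist C y + mdist x y.
Proof.
rewrite -lerBlDr; have [ne lb] := bd_has_inf y.
apply: lb_le_inf => // _ [p pb <-]; rewrite lerBlDr addrC.
have [_ lbx] := bd_has_inf x.
apply: (@le_trans _ _ (mdist (to_completion C x) p)).
  by apply: ge_inf => //; exists p.
by rewrite -(to_completion_isometry C); exact: metric_triangle.
Qed.

Let ge1 (x y z : X) : 1 <= 1 + mdist x y / boundary_dist C z.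
Proof. by rewrite lerDl divr_ge0 ?mdist_ge0// ltW// boundary_dist_gt0. Qed.

Lemma jtildexx x : jtilde C x x = 0.
Proof. by rewrite /jtilde mdistxx !mul0r addr0 mulr1 ln1 mulr0. Qed.

Lemma jtilde_sym x y : jtilde C x y = jtilde C y x.
Proof. by rewrite /jtilde metric_sym [X in ln X]mulrC. Qed.

Lemma jtilde_positivity x y : jtilde C x y = 0 -> x = y.
Proof.
move=> /eqP; rewrite mulf_eq0 invr_eq0 pnatr_eq0/=.
apply: contraTeq => xy.
have d0 := boundary_dist_gt0; have xy0 : 0 < mdist x y by rewrite mdist_gt0.
rewrite gt_eqF// ln_gt0// (@lt_le_trans _ _ (1 + mdist x y / boundary_dist C x))//.
  by rewrite ltrDl divr_gt0.
by rewrite ler_peMr// ?ge1// (le_trans ler01)// ge1.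
Qed.

Lemma jtilde_triangle z x y : jtilde C x y <= jtilde C x z + jtilde C z y.
Proof.
have p (a b c : X) : 0 < 1 + mdist a b / boundary_dist C c.
  exact: lt_le_trans ltr01 (ge1 a b c).
rewrite /jtilde -mulrDr ler_pM2l ?invr_gt0// -lnM ?posrE ?mulr_gt0//.
rewrite ler_ln ?posrE ?mulr_gt0//.
have dx := boundary_dist_gt0 x; have dy := boundary_dist_gt0 y.
have dz := boundary_dist_gt0 z.
have zx := boundary_dist_le z x; have zy := boundary_dist_le z y.
have /= xyz := metric_triangle x z y.
have a0 := mdist_ge0 x z; have b0 := mdist_ge0 z y; have c0 := mdist_ge0 x y.
rewrite (metric_sym z x) in zx.
move: (boundary_dist C x) (boundary_dist C y) (boundary_dist C z) (mdist x z)
  (mdist z y) (mdist x y) dx dy dz zx zy xyz a0 b0 c0 {p}.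
move=> dx dy dz a b c dx0 dy0 dz0 zx zy cab a0 b0 c0.
have key u s t : 0 < u -> 0 <= s -> 0 <= t -> dz <= u + s -> c <= s + t ->
    1 + c / u <= (1 + s / u) * (1 + t / dz).
  move=> u0 s0 t0 dzu cst.
  have -> : (1 + s / u) * (1 + t / dz) =
      1 + (s + t * ((u + s) / dz)) / u.
    by field; rewrite !gt_eqF.
  rewrite lerD2l ler_pM2r ?invr_gt0// (le_trans cst)// lerD2l ler_peMr//.
  by rewrite ler_pdivlMr// mul1r.
have h1 := key dx a b dx0 a0 b0 zx cab.
have h2 : 1 + c / dy <= (1 + b / dy) * (1 + a / dz).
  by apply: key => //; rewrite addrC.
have -> : (1 + a / dx) * (1 + a / dz) * ((1 + b / dz) * (1 + b / dy)) =
  ((1 + a / dx) * (1 + b / dz)) * ((1 + b / dy) * (1 + a / dz)) by ring.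
by apply: ler_pM => //; rewrite addr_ge0// divr_ge0// ltW.
Qed.

End JtildeMetric.

Definition jtilde_space {R : realType} (X : metricType R) (C : completion X)
  (lc : locally_complete X) (inc : metric_boundary C !=set0) : Type := X.

HB.instance Definition _ {R : realType} (X : metricType R) (C : completion X)
    (lc : locally_complete X) (inc : metric_boundary C !=set0) :=
  Choice.on (jtilde_space lc inc).

HB.instance Definition _ {R : realType} (X : metricType R) (C : completion X)
    (lc : locally_complete X) (inc : metric_boundary C !=set0) :=
  @isMetric.Build R (jtilde_space lc inc) (@jtilde R X C)
    (@jtildexx R X C) (jtilde_positivity lc inc) (@jtilde_sym R X C)
    (jtilde_triangle lc inc).

Lemma mdist_jtildeE {R : realType} (X : metricType R) (C : completion X)
    (lc : locally_complete X) (inc : metric_boundary C !=set0)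
    (x y : jtilde_space lc inc) : mdist x y = jtilde C x y.
Proof. by []. Qed.

Section Gromov.
Context {R : realType} (X : metricType R).

Definition gromov_prod (w x y : X) : R :=
  (mdist x w + mdist y w - mdist x y) / 2.

Definition hyperbolic (delta : R) : Prop := forall x y z w : X,
  Num.min (gromov_prod w x z) (gromov_prod w z y) - delta <= gromov_prod w x y.

Definition gromov_hyperbolic : Prop :=
  exists2 delta : R, 0 <= delta & hyperbolic delta.

(* Changing the base point w changes the Gromov product by at most the distance
   of the base points, so "for all w" and "for some w" agree here. *)
Definition gromov_seq (x : nat -> X) : Prop := forall w,
  gromov_prod w (x ij.1) (x ij.2) @[ij --> (\oo, \oo)] --> +oo.

Definition gromov_equiv (x y : nat -> X) : Prop := forall w,
  gromov_prod w (x i) (y i) @[i --> \oo] --> +oo.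

Definition gromov_boundary : set (set (nat -> X)) :=
  [set [set y | gromov_seq y /\ gromov_equiv x y] | x in gromov_seq].

Local Open Scope ereal_scope.

Definition gromov_prod_pb (w x : X) (xi : gromov_boundary) : \bar R :=
  ereal_inf [set limn_einf (fun i => (gromov_prod w x (y i))%:E)
            | y in val xi].

Definition gromov_prod_bb (w : X) (xi zeta : gromov_boundary) : \bar R :=
  ereal_inf [set limn_einf (fun i => (gromov_prod w (x i) (y i))%:E)
            | x in val xi & y in val zeta].

(* Both products are finite: they lie between 0 and the distance of x to w. *)
Definition busemann (xi : gromov_boundary) (w x : X) : R :=
  (fine (gromov_prod_pb x w xi) - fine (gromov_prod_pb w x xi))%R.

Definition busemann_functions (xi : gromov_boundary) : set (X -> R) :=
  range (busemann xi).

Definition busemann_prod (b : X -> R) (x y : X) : R :=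
  ((b x + b y - mdist x y) / 2)%R.

Definition busemann_prod_bb (b : X -> R) (xi1 xi2 : gromov_boundary) : \bar R :=
  ereal_inf [set limn_einf (fun i => (busemann_prod b (x i) (y i))%:E)
            | x in val xi1 & y in val xi2].

(* In a hyperbolic space with b based at a point other than xi1 and xi2, the
   product is never -oo, and it is +oo exactly when xi1 = xi2, in which case
   [expeR -oo = 0]. *)
Definition hamenstadt_rho (b : X -> R) (eps : R) (xi1 xi2 : gromov_boundary)
    : R :=
  fine (expeR (- (eps%:E * busemann_prod_bb b xi1 xi2))).

Local Open Scope ring_scope.

Definition punctured_boundary (xi : gromov_boundary) : set gromov_boundary :=
  ~` [set xi].

Definition hamenstadt (xi : gromov_boundary) (b : X -> R) (eps : R)
    (xi1 xi2 : punctured_boundary xi) : R :=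
  inf [set s | exists n (zeta : nat -> punctured_boundary xi),
    [/\ (0 < n)%N, zeta 0%N = xi1, zeta n = xi2 &
        s = \sum_(i < n) hamenstadt_rho b eps (val (zeta i)) (val (zeta i.+1))]].

Definition admissible (delta eps : R) : Prop :=
  0 < eps /\ expR (22 * eps * delta) <= 2.

Definition bordification : Type := (X + gromov_boundary)%type.

HB.instance Definition _ := Choice.on bordification.

Definition bordification_prod (w : X) (z : bordification)
    (zeta : gromov_boundary) : \bar R :=
  match z with
  | inl x => gromov_prod_pb w x zeta
  | inr xi => gromov_prod_bb w xi zeta
  end.

(* As above, the choice of the base point w is immaterial. *)
Definition bordification_open (A : set bordification) : Prop :=
  open [set x | A (inl x)] /\
  forall zeta, A (inr zeta) -> forall w, exists2 t : R, 0 < t &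
    [set z | (t%:E < bordification_prod w z zeta)%E] `<=` A.

Let bordification_openT : bordification_open setT.
Proof. by split=> [|zeta _ w]; [exact: openT|exists 1]. Qed.

Let bordification_openI : setI_closed bordification_open.
Proof.
move=> A B [oA nA] [oB nB]; split=> [|zeta [Az Bz] w]; first exact: openI.
have [s s0 sA] := nA _ Az w; have [t t0 tB] := nB _ Bz w.
exists (Num.max s t) => [|z /= zst]; first by rewrite lt_max s0.
split; [apply: sA|apply: tB] => /=; apply: le_lt_trans zst;
  by rewrite lee_fin le_max lexx ?orbT.
Qed.

Let bordification_open_bigU (I : Type) (f : I -> set bordification) :
  (forall i, bordification_open (f i)) -> bordification_open (\bigcup_i f i).
Proof.
move=> fo; split=> [|zeta [i _ fi] w].
  have -> : [set x | (\bigcup_i f i) (inl x)] =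
      \bigcup_i [set x | f i (inl x)] by [].
  by apply: bigcup_open => i _; have [] := fo i.
by have [_ /(_ _ fi w)[t t0 tf]] := fo i; exists t => // z /tf; exists i.
Qed.

HB.instance Definition _ := @isOpenTopological.Build bordification
  bordification_open bordification_openT bordification_openI
  bordification_open_bigU.

End Gromov.

Arguments gromov_boundary {R} X _.
Arguments gromov_hyperbolic {R} X.
Arguments hyperbolic {R} X delta.

Section NaturalMaps.
Context {R : realType}.

Definition with_infinity (Y : metricType R) : Type := option Y.

HB.instance Definition _ (Y : metricType R) := Choice.on (with_infinity Y).

Definition with_infinity_open (Y : metricType R) (U : set (with_infinity Y))
    : Prop :=
  open [set y | U (Some y)] /\
  (U None -> metric_bounded (~` [set y | U (Some y)])).

Section topology.
Variable Y : metricType R.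

Let woT : with_infinity_open [set: with_infinity Y].
Proof.
by split; [exact: openT|exists 0 => x y; rewrite /setC/= => /(_ I)].
Qed.

Let woI : setI_closed (@with_infinity_open Y).
Proof.
move=> A B [oA nA] [oB nB]; split=> [|[/nA[M AM] /nB[N BN]]]; first exact: openI.
have [[a Aa]|nAa] := pselect (exists a, ~ A (Some a)); last first.
  have A1 x : A (Some x) by apply: contrapT => ?; apply: nAa; exists x.
  by exists N => x y nx ny; apply: BN => ?; [apply: nx|apply: ny]; split.
have [[b Bb]|nBb] := pselect (exists b, ~ B (Some b)); last first.
  have B1 x : B (Some x) by apply: contrapT => ?; apply: nBb; exists x.
  by exists M => x y nx ny; apply: AM => ?; [apply: nx|apply: ny]; split.
have h x : ~ (A `&` B) (Some x) -> mdist x a <= `|M| + `|N| + mdist b a.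
  move=> /not_andP[] nx.
    by rewrite (le_trans (AM x a nx Aa))// (le_trans (ler_norm M))// -addrA
      lerDl addr_ge0 ?mdist_ge0.
  rewrite (le_trans (metric_triangle x b a))// lerD2r.
  by rewrite (le_trans (BN x b nx Bb))// (le_trans (ler_norm N))// lerDr.
exists ((`|M| + `|N| + mdist b a) + (`|M| + `|N| + mdist b a)) => x y nx ny.
rewrite (le_trans (metric_triangle x a y))// lerD ?h//.
by rewrite metric_sym h.
Qed.

Let wo_bigU (I : Type) (f : I -> set (with_infinity Y)) :
  (forall i, with_infinity_open (f i)) -> with_infinity_open (\bigcup_i f i).
Proof.
move=> fo; split=> [|[i _ fi]].
  have -> : [set x | (\bigcup_i f i) (Some x)] =
      \bigcup_i [set x | f i (Some x)] by [].
  by apply: bigcup_open => i _; have [] := fo i.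
have [_ /(_ fi)[M fM]] := fo i; exists M => x y nx ny.
by apply: fM => h; [apply: nx|apply: ny]; exists i.
Qed.

HB.instance Definition _ := @isOpenTopological.Build (with_infinity Y)
  (@with_infinity_open Y) woT woI wo_bigU.

End topology.

(* [M] is a second metric on [X] and [h] the identity map. The points of the
   metric boundary together with infinity are the elements of
   [option (metric_boundary C)], with [None] for infinity. *)
Definition extension_map (X M : metricType R) (C : completion X) (h : M -> X)
    (psi : gromov_boundary M -> option (metric_boundary C))
    (z : bordification M) : with_infinity C :=
  match z with
  | inl x => Some (to_completion C (h x))
  | inr zeta => omap val (psi zeta)
  end.

Definition natural_map (X M : metricType R) (C : completion X) (h : M -> X)
    (psi : gromov_boundary M -> option (metric_boundary C)) : Prop :=
  continuous (extension_map h psi).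

End NaturalMaps.

Section Quasisymmetry.
Context {R : realType}.

Definition dist_continuous (Y Y' : Type) (sigma : Y -> Y -> R)
    (sigma' : Y' -> Y' -> R) (f : Y -> Y') : Prop :=
  forall x (e : R), 0 < e -> exists2 r : R, 0 < r &
    forall y, sigma x y < r -> sigma' (f x) (f y) < e.

Definition dist_homeomorphism (Y Y' : Type) (sigma : Y -> Y -> R)
    (sigma' : Y' -> Y' -> R) (f : Y -> Y') : Prop :=
  dist_continuous sigma sigma' f /\
  exists g : Y' -> Y,
    [/\ cancel f g, cancel g f & dist_continuous sigma' sigma g].

Definition homeomorphism_Rge0 (eta : R -> R) : Prop :=
  [/\ set_bij `[0, +oo[ `[0, +oo[ eta,
      {within `[0, +oo[, continuous eta} &
      exists g : R -> R, [/\ set_fun `[0, +oo[ `[0, +oo[ g,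
        {in `[0, +oo[, cancel eta g} & {within `[0, +oo[, continuous g}]].

Definition quasisymmetric (eta : R -> R) (Y Y' : Type) (sigma : Y -> Y -> R)
    (sigma' : Y' -> Y' -> R) (f : Y -> Y') : Prop :=
  dist_homeomorphism sigma sigma' f /\
  forall (t : R) (x y z : Y), 0 < t -> sigma x y <= t * sigma x z ->
    sigma' (f x) (f y) <= eta t * sigma' (f x) (f z).

End Quasisymmetry.

(* Main.v *)
(** Put [hprod x y = (d(x) + d(x,y)) * (d(y) + d(x,y))], so that the metric is
[1/2 ln (hprod x y / (d(x) d(y)))] and the Gromov product is
[(x|y)_w = 1/4 ln (hprod x w * hprod y w / (hprod x y * d(w)^2))].
Up to a factor [4], [hprod] is the square of [hsum = d(x,y) + d(x) + d(y)],
which satisfies the triangle inequality; this gives hyperbolicity, and shows that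
a Gromov sequence either converges to a boundary point or leaves every bounded
set, all sequences of the latter kind being equivalent and defining [xi].

When [y] tends to infinity, [hprod x y / hprod w y] tends to [1]. Hence the Busemann
function of [xi] based at [w] is exactly [1/2 ln (d(w) / d(x))], the
associated product is [1/4 ln (d(w)^2 / hprod x y)], and for boundary points [p], [q]
one gets exactly [rho = (d(p,q) / d(w))^(eps/2)]. Sending one of four points to
infinity in the [delta]-inequality yields
[d(p,q) <= e^(2 delta) max (d(p,r), d(r,q))], so admissibility makes [rho]
satisfy [rho(x,y) <= 2 max (rho(x,z), rho(z,u), rho(u,y))], and Frink's chain
argument bounds the Hamenstaedt metric below by [rho / 2]. Therefore
[eta t = (2 t)^(2/eps)] works. *)

Require Import Defs.
From HB Require Import structures.
From mathcomp Require Import all_boot all_order all_algebra.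
From mathcomp Require Import all_classical all_reals all_analysis.
From mathcomp Require Import ring lra.
Import Order.TTheory GRing.Theory Num.Theory.
Import numFieldNormedType.Exports.

Set Implicit Arguments.
Unset Strict Implicit.
Unset Printing Implicit Defensive.

Local Open Scope classical_set_scope.
Local Open Scope ring_scope.

(** * The Gromov product of jtilde *)

Section JtildeProduct.
Context {R : realType} (X : metricType R) (C : completion X).
Context (lc : locally_complete X) (inc : metric_boundary C !=set0).

Let Xj : metricType R := jtilde_space lc inc.
Let D (x : X) : R := boundary_dist C x.

Definition hsum (x y : X) : R :=
  mdist x y + boundary_dist C x + boundary_dist C y.

Definition hprod (x y : X) : R :=
  (boundary_dist C x + mdist x y) * (boundary_dist C y + mdist x y).

Let D_gt0 x : 0 < D x. Proof. exact: boundary_dist_gt0. Qed.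

Let D_le x y : D x <= D y + mdist x y. Proof. exact: boundary_dist_le. Qed.

Lemma hprodC x y : hprod x y = hprod y x.
Proof. by rewrite /hprod metric_sym mulrC. Qed.

Lemma hsumC x y : hsum x y = hsum y x.
Proof. by rewrite /hsum metric_sym addrAC. Qed.

Lemma hprod_gt0 x y : 0 < hprod x y.
Proof. by rewrite mulr_gt0// ltr_pwDl// ?D_gt0// mdist_ge0. Qed.

Lemma hsum_ge_boundary_dist x y : boundary_dist C y <= hsum x y.
Proof. by have := D_gt0 x; have := mdist_ge0 x y; rewrite /hsum /D; lra. Qed.

Lemma hsum_gt0 x y : 0 < hsum x y.
Proof. exact: lt_le_trans (D_gt0 y) (hsum_ge_boundary_dist x y). Qed.

Lemma hsum_triangle z x y : hsum x y <= hsum x z + hsum z y.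
Proof.
have := D_gt0 z; have /= := metric_triangle x z y.
by rewrite /hsum /D; lra.
Qed.

Lemma hsum_le x y : hsum x y <= 2 * mdist x y + 2 * boundary_dist C y.
Proof. by have := D_le x y; rewrite /hsum /D; lra. Qed.

Lemma hprod_le x y : hprod x y <= hsum x y ^+ 2.
Proof.
have := D_gt0 x; have := D_gt0 y; have := mdist_ge0 x y.
by rewrite /hprod /hsum /D expr2 => *; apply: ler_pM; lra.
Qed.

(** Since [boundary_dist] is 1-Lipschitz, twice either factor of [hprod x y] dominates
    [hsum x y]. *)
Lemma hsum_le_hprod x y : hsum x y ^+ 2 <= 4 * hprod x y.
Proof.
have xy := D_le x y; have yx := D_le y x; rewrite (metric_sym y x) in yx.
have := D_gt0 x; have := D_gt0 y; have := mdist_ge0 x y.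
have -> : 4 * hprod x y = (2 * (D x + mdist x y)) * (2 * (D y + mdist x y)).
  by rewrite /hprod /D; ring.
by move: xy yx; rewrite /hsum /D expr2 => *; apply: ler_pM; lra.
Qed.

Lemma jtildeE x y : jtilde C x y =
  2^-1 * ln (hprod x y / (boundary_dist C x * boundary_dist C y)).
Proof.
have x0 := lt0r_neq0 (D_gt0 x); have y0 := lt0r_neq0 (D_gt0 y).
rewrite /jtilde /hprod; congr (_ * ln _); move: x0 y0.
by rewrite /D => *; field; apply/andP.
Qed.

Lemma gromov_prodE (w x y : Xj) : gromov_prod w x y =
  4^-1 * ln (hprod x w * hprod y w / (hprod x y * boundary_dist C w ^+ 2)).
Proof.
have h := hprod_gt0; rewrite /gromov_prod !mdist_jtildeE !jtildeE.
have Dx := D_gt0 x; have Dy := D_gt0 y; have Dw := D_gt0 w.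
rewrite /D in Dx Dy Dw; have := h x y; have := h x w; have := h y w.
move: (hprod x y) (hprod x w) (hprod y w) => p q r *.
rewrite !(ln_div, lnM, expr2) ?posrE ?mulr_gt0//.
by field.
Qed.

Lemma jtilde_gromov_prodC (w x y : Xj) : gromov_prod w x y = gromov_prod w y x.
Proof. by rewrite /gromov_prod [mdist x y]metric_sym (addrC (mdist x w)). Qed.

(** Exponentiating turns bounds on Gromov products into polynomial inequalities in [hprod], the form
    used in the four estimates that follow. *)
Lemma lt_gromov_prod (t : R) (w x y : Xj) : (t < gromov_prod w x y) =
  (expR (4 * t) * (hprod x y * boundary_dist C w ^+ 2) < hprod x w * hprod y w).
Proof.
have h := hprod_gt0; have Dw := D_gt0 w; rewrite /D in Dw.
have d0 : 0 < hprod x y * boundary_dist C w ^+ 2 by rewrite mulr_gt0// exprn_gt0.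
rewrite -ltr_pdivlMr// gromov_prodE ltr_pdivlMl// -[LHS]ltr_expR lnK//.
by rewrite posrE divr_gt0// mulr_gt0.
Qed.

Lemma exists_expR4_ge (A : R) : 0 <= A ->
  exists2 t : R, 0 < t & A <= expR (4 * t).
Proof.
move=> A0; exists (A + 1); first by rewrite ltr_wpDl.
by apply: le_trans (expR_ge1Dx _); lra.
Qed.

(** * Estimates linking the size of Gromov products to [hsum] *)

(** If [hsum x y] were at least [e], the triangle inequality through [y] would bound [hsum x w] by a
    fixed multiple of [hsum x y], and the quotient inside the logarithm would stay bounded. This is
    the source of the Cauchy property in [gromov_seq_limit]. *)
Lemma hsum_small_of_gromov_prod (w : X) (M e : R) : 0 < e ->
  exists2 t : R, 0 < t & forall x y : X, hsum y w <= M ->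
    t < @gromov_prod R Xj w x y -> hsum x y < e.
Proof.
(* Multiplying [A] by the lower bound [hsum x y ^+ 2 / 4] of [hprod x y] and by [D w ^+ 2] gives the
   perfect square [((1 + M / e) * M * hsum x y) ^+ 2]. *)
move=> e0; set A := 4 * ((1 + M / e) * M) ^+ 2 / D w ^+ 2.
have A0 : 0 <= A.
  by apply: divr_ge0; [apply: mulr_ge0; rewrite // sqr_ge0|exact: sqr_ge0].
have [t t0 At] := exists_expR4_ge A0.
exists t => // x y yM; rewrite lt_gromov_prod; apply: contraTT.
rewrite -!leNgt => es.
have M0 : 0 < M by apply: lt_le_trans yM; exact: hsum_gt0.
have s0 := lt_le_trans e0 es.
have Dw := D_gt0 w; have Dw2 : 0 < D w ^+ 2 by rewrite exprn_gt0.
apply: (@le_trans _ _ (A * (hsum x y ^+ 2 / 4 * D w ^+ 2))); last first.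
  apply: ler_pM => //.
    by apply: mulr_ge0; [rewrite divr_ge0// sqr_ge0|exact: sqr_ge0].
  by rewrite ler_pM2r// ler_pdivrMr// mulrC hsum_le_hprod.
have -> : A * (hsum x y ^+ 2 / 4 * D w ^+ 2) =
    (((1 + M / e) * M) * hsum x y) ^+ 2.
  by rewrite /A; field; rewrite !gt_eqF.
have xw : hsum x w <= (1 + M / e) * hsum x y.
  apply: le_trans (hsum_triangle y _ _) _; rewrite mulrDl mul1r lerD2l.
  rewrite (le_trans yM)// mulrAC ler_pdivlMr// ler_pM2l//.
apply: (@le_trans _ _ (hsum x w ^+ 2 * hsum y w ^+ 2)).
  by apply: ler_pM; rewrite ?hprod_le// ltW// hprod_gt0.
have Me : 0 < 1 + M / e by rewrite addr_gt0// divr_gt0.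
rewrite -exprMn lerXn2r// ?nnegrE;
  last by rewrite [leRHS]mulrAC ler_pM// ltW// hsum_gt0.
  by rewrite mulr_ge0// ltW// hsum_gt0.
by rewrite ltW// !mulr_gt0// hsum_gt0.
Qed.

(** Here [hsum x w] is at most half of [hsum y w], so [hsum y w <= 2 * hsum x y]: the distant point
    [y] cancels from the quotient up to a constant. *)
Lemma gromov_prod_bounded (w : X) (N : R) :
  exists2 t : R, 0 < t & forall x y : X, hsum x w <= N -> 2 * N <= hsum y w ->
    @gromov_prod R Xj w x y <= t.
Proof.
set A := 4 * (2 * N) ^+ 2 / D w ^+ 2.
have A0 : 0 <= A.
  by apply: divr_ge0; [apply: mulr_ge0; rewrite // sqr_ge0|exact: sqr_ge0].
have [t t0 At] := exists_expR4_ge A0.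
exists t => // x y xN yN; rewrite leNgt lt_gromov_prod -leNgt.
have Dw := D_gt0 w; have Dw2 : 0 < D w ^+ 2 by rewrite exprn_gt0.
apply: (@le_trans _ _ (A * (hsum x y ^+ 2 / 4 * D w ^+ 2))); last first.
  apply: ler_pM => //.
    by apply: mulr_ge0; [rewrite divr_ge0// sqr_ge0|exact: sqr_ge0].
  by rewrite ler_pM2r// ler_pdivrMr// mulrC hsum_le_hprod.
have -> : A * (hsum x y ^+ 2 / 4 * D w ^+ 2) = (N * (2 * hsum x y)) ^+ 2.
  by rewrite /A; field; rewrite !gt_eqF.
have yw : hsum y w <= 2 * hsum x y.
  by have := hsum_triangle x y w; rewrite (hsumC y x); lra.
apply: (@le_trans _ _ (hsum x w ^+ 2 * hsum y w ^+ 2)).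
  by apply: ler_pM; rewrite ?hprod_le// ltW// hprod_gt0.
have N0 : 0 < N by apply: lt_le_trans xN; exact: hsum_gt0.
rewrite -exprMn lerXn2r// ?nnegrE; last by rewrite ler_pM// ltW// hsum_gt0.
  by rewrite mulr_ge0// ltW// hsum_gt0.
by rewrite ltW// !mulr_gt0// hsum_gt0.
Qed.

(** If [y] is the farther point from [w], then [hprod x y] is at most [4 * hsum y w ^+ 2]; this
    cancels against [hprod y w], and the remaining factor grows with [hsum x w]. *)
Lemma gromov_prod_large_of_far (w : X) (T : R) :
  exists N : R, forall x y : X, N <= hsum x w -> N <= hsum y w ->
    T < @gromov_prod R Xj w x y.
Proof.
have Dw := D_gt0 w; have Dw2 : 0 < D w ^+ 2 by rewrite exprn_gt0.
set B := expR (4 * T) * D w ^+ 2.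
have B0 : 0 < B by rewrite mulr_gt0// expR_gt0.
(* The constant [8] makes [hsum x w ^+ 2] exceed [64 * B]: one factor [4] comes from [hprod x y],
   and one from each of the two lower bounds. *)
exists (8 * (B + 1)) => x y.
wlog xy : x y / hsum x w <= hsum y w.
  move=> h xN yN; have [|/ltW] := leP (hsum x w) (hsum y w) => xy; first exact: h.
  by rewrite jtilde_gromov_prodC; exact: h.
move=> xN yN; rewrite lt_gromov_prod.
have -> : expR (4 * T) * (hprod x y * boundary_dist C w ^+ 2) = B * hprod x y.
  by rewrite /B; ring.
apply: (@lt_le_trans _ _ ((hsum x w ^+ 2 / 4) * (hsum y w ^+ 2 / 4))); last first.
  apply: ler_pM; rewrite ?divr_ge0 ?sqr_ge0// ler_pdivrMr// mulrC;
    exact: hsum_le_hprod.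
have xy2 : hprod x y <= (2 * hsum y w) ^+ 2.
  apply: le_trans (hprod_le _ _) _.
  apply: lerXn2r; rewrite ?nnegrE ?mulr_ge0// ?(ltW (hsum_gt0 _ _))//.
  by have := hsum_triangle w x y; rewrite (hsumC w y); lra.
apply: (@le_lt_trans _ _ (B * (2 * hsum y w) ^+ 2)); first by rewrite ler_pM2l.
have a0 : 64 * B < hsum x w ^+ 2.
  apply: (@lt_le_trans _ _ ((8 * (B + 1)) ^+ 2)); first by nra.
  by apply: lerXn2r; rewrite ?nnegrE ?(ltW (hsum_gt0 _ _))//; lra.
have b0 : 0 < hsum y w ^+ 2 by rewrite exprn_gt0// hsum_gt0.
by rewrite exprMn; move: a0; rewrite -subr_gt0 => /mulr_gt0/(_ b0); lra.
Qed.

(** The product [hprod x w * hprod y w] is at least [D w ^+ 4 / 16], because [hsum z w >= D w] for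
    every [z], while [hprod x y] is at most [hsum x y ^+ 2]. *)
Lemma gromov_prod_large_of_close (w : X) (T : R) :
  exists2 e : R, 0 < e & forall x y : X, hsum x y < e ->
    T < @gromov_prod R Xj w x y.
Proof.
have Dw := D_gt0 w; have Dw2 : 0 < D w ^+ 2 by rewrite exprn_gt0.
set B := 16 * expR (4 * T).
have B0 : 0 < B by rewrite mulr_gt0// expR_gt0.
exists (D w / (B + 1)); first by rewrite divr_gt0// addr_gt0.
move=> x y; rewrite lt_gromov_prod ltr_pdivlMr ?addr_gt0// => xye.
apply: (@lt_le_trans _ _ ((D w ^+ 2 / 4) * (D w ^+ 2 / 4))); last first.
  have h z : D w ^+ 2 / 4 <= hprod z w.
    rewrite ler_pdivrMr// mulrC; apply: le_trans (hsum_le_hprod _ _).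
    apply: lerXn2r; rewrite ?nnegrE ?(ltW (hsum_gt0 _ _)) ?(ltW Dw)//.
    exact: hsum_ge_boundary_dist.
  by apply: ler_pM => //; rewrite divr_ge0 ?sqr_ge0.
have sB : (hsum x y * (B + 1)) ^+ 2 < D w ^+ 2.
  by rewrite ltr_pXn2r// ?nnegrE ltW// mulr_gt0 ?hsum_gt0 ?addr_gt0.
have pB : hprod x y * B < D w ^+ 2.
  apply: le_lt_trans sB; rewrite exprMn; apply: ler_pM => //.
  - exact/ltW/hprod_gt0.
  - exact: ltW.
  - exact: hprod_le.
  - by nra.
have -> : expR (4 * T) * (hprod x y * boundary_dist C w ^+ 2) =
    hprod x y * B / 16 * D w ^+ 2 by rewrite /B /D; field.
by move: pB; rewrite -subr_gt0 => /mulr_gt0/(_ Dw2); lra.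
Qed.

(** * Hyperbolicity as a four-point inequality *)

(** The triangle inequality for [hsum] is squared with [(a + b)^2 <= 2 a^2 + 2 b^2]; the comparison
    with [hprod] contributes a further factor [4]. *)
Lemma hprod_quasi_ultrametric (z x y : X) :
  hprod x y <= 16 * hprod x z \/ hprod x y <= 16 * hprod z y.
Proof.
have : hprod x y <= 8 * hprod x z + 8 * hprod z y.
  apply: le_trans (hprod_le _ _) _.
  apply: (@le_trans _ _ ((hsum x z + hsum z y) ^+ 2)).
    apply: lerXn2r; last exact: hsum_triangle.
      by rewrite nnegrE ltW// hsum_gt0.
    by rewrite nnegrE; apply: addr_ge0; exact/ltW/hsum_gt0.
  have := hsum_le_hprod x z; have := hsum_le_hprod z y.
  by have := sqr_ge0 (hsum x z - hsum z y); nra.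
by case: (leP (hprod x z) (hprod z y)) => ? ?; [right|left]; lra.
Qed.

(** The factors [hprod x w] and [boundary_dist C w ^+ 2] cancel, and the factor [1/4] before the
    logarithm turns [K] into [K ^+ 4]. *)
Lemma gromov_prod_le_hprod (K : R) (w x y z : Xj) : 0 < K ->
  (gromov_prod w x z - ln K <= gromov_prod w x y) =
  (hprod x y * hprod z w <= K ^+ 4 * (hprod x z * hprod y w)).
Proof.
move=> K0; have h := hprod_gt0; have Dw := D_gt0 w; rewrite /D in Dw.
rewrite !gromov_prodE; have := h x y; have := h x z.
have := h x w; have := h y w; have := h z w.
have K4 : 0 < K ^+ 4 by rewrite exprn_gt0.
have lK : ln (K ^+ 4) = 4 * ln K by rewrite lnXn// mulr_natl.
move: (hprod x y) (hprod x w) (hprod y w) (hprod x z) (hprod z w) => p q r s t.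
move: (K ^+ 4) K4 lK => k k0 lK *.
rewrite -[RHS]ler_ln ?posrE ?mulr_gt0//.
rewrite !(ln_div, lnM, expr2) ?posrE ?mulr_gt0// lK.
by apply/idP/idP; lra.
Qed.

(** In this form the base point [w] enters like the other three points, so it can later be sent to
    infinity. *)
Lemma jtilde_hyperbolicP (K : R) : 0 < K ->
  hyperbolic Xj (ln K) <-> forall x y z w,
  hprod x y * hprod z w <= K ^+ 4 * (hprod x z * hprod y w) \/
  hprod x y * hprod z w <= K ^+ 4 * (hprod z y * hprod x w).
Proof.
move=> K0; split=> hyp x y z w.
  have := hyp x y z w; rewrite lerBlDr ge_min -!lerBlDr => /orP[].
    by rewrite gromov_prod_le_hprod//; left.
  rewrite jtilde_gromov_prodC (jtilde_gromov_prodC w x) gromov_prod_le_hprod//.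
  by rewrite (hprodC y x) (hprodC y z); right.
rewrite lerBlDr ge_min -!lerBlDr; apply/orP.
have [h|h] := hyp x y z w; [left|right]; first by rewrite gromov_prod_le_hprod.
rewrite jtilde_gromov_prodC (jtilde_gromov_prodC w x) gromov_prod_le_hprod//.
by rewrite (hprodC y x) (hprodC y z).
Qed.

Lemma jtilde_gromov_hyperbolic : gromov_hyperbolic Xj.
Proof.
exists (ln 4); first by rewrite ln_ge0// ler1n.
apply/jtilde_hyperbolicP => // x y z w.
(* The constant is [16 * 16], from multiplying two instances of the quasi-ultrametric inequality. *)
have -> : 4 ^+ 4 = 256 :> R by ring.
have h := hprod_gt0; have a0 := h x y; have b0 := h z w.
have := hprod_quasi_ultrametric z x y; have := hprod_quasi_ultrametric w x y.
have := hprod_quasi_ultrametric x z w; have := hprod_quasi_ultrametric y z w.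
have := h z y; have := h y w; have := h x z; have := h x w.
rewrite (hprodC w y) (hprodC z x).
move: (hprod x y) (hprod z w) (hprod x z) (hprod y w) (hprod z y) (hprod x w) a0 b0.
move=> a b p q r s a0 b0 s0 p0 q0 r0 h1 h2 h3 h4.
case: (leP (a * b) (256 * (p * q))) => pq; [by left|right].
rewrite leNgt; apply/negP => rs.
have M (c d u v : R) : 0 < c -> 0 < d -> c <= 16 * u -> d <= 16 * v ->
    c * d <= 256 * (u * v).
  move=> /ltW c0 /ltW d0 cu dv; have := ler_pM c0 d0 cu dv.
  by congr (_ <= _); ring.
have lt_sq : a * a < a * b -> b * b < a * b -> False.
  by rewrite ltr_pM2l// ltr_pM2r// => ab /(lt_trans ab); rewrite ltxx.
(* If a bound on [a] and a bound on [b] use the two factors of one pairing, [p q] or [r s], they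
   multiply to a bound on [a * b]. Otherwise both bounds on [a] come from one pairing and both
   bounds on [b] from the other; then [a * a] and [b * b] are both below [a * b], which is
   absurd. *)
move: h1 h2 h3 h4 => [] h1 [] h2 [] h3 [] h4;
  first [ by have := M _ _ p q a0 b0 h4 h1; lra
        | by have := M _ _ q p a0 b0 h3 h2; lra
        | by have := M _ _ r s a0 b0 h4 h2; lra
        | by have := M _ _ s r a0 b0 h3 h1; lra
        | by apply: lt_sq;
            [have := M _ _ p q a0 a0 h4 h3|have := M _ _ r s b0 b0 h1 h2]; lra
        | by apply: lt_sq;
            [have := M _ _ r s a0 a0 h4 h3|have := M _ _ q p b0 b0 h1 h2]; lra ].
Qed.

End JtildeProduct.

(** * Gromov sequences *)

Lemma gromov_seqP (R : realType) (M : metricType R) (x : nat -> M) :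
  gromov_seq x <-> forall w A, exists N, forall i j, (N <= i)%N -> (N <= j)%N ->
    A < gromov_prod w (x i) (x j).
Proof.
split=> h w.
  move=> A; have /cvgryPgt/(_ A)[[P Q] /= [[N1 _ PN1] [N2 _ QN2]] sub] := h w.
  exists (maxn N1 N2) => i j; rewrite !geq_max => /andP[i1 _] /andP[_ j2].
  exact: (sub (i, j) (conj (PN1 _ i1) (QN2 _ j2))).
apply/cvgryPgt => A; have [N hN] := h w A.
exists ([set n | (N <= n)%N], [set n | (N <= n)%N]); first by split; exists N.
by move=> [i j] /= [iN jN]; exact: hN.
Qed.

Section BoundarySequences.
Context {R : realType} (X : metricType R) (C : completion X).
Context (lc : locally_complete X) (inc : metric_boundary C !=set0).

Let Xj : metricType R := jtilde_space lc inc.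
Let D (x : X) : R := boundary_dist C x.
Let D_gt0 x : 0 < D x. Proof. exact: boundary_dist_gt0. Qed.

Definition seq_to_point (p : C) : set (nat -> X) :=
  [set x | mdist (to_completion C (x n)) p @[n --> \oo] --> (0 : R)].

Definition seq_to_infinity : set (nat -> X) :=
  [set x | forall w, mdist (x n) w @[n --> \oo] --> +oo].

Lemma seq_to_pointP p x : seq_to_point p x <->
  forall e, 0 < e -> \forall n \near \oo, mdist (to_completion C (x n)) p < e.
Proof.
split=> [/cvgr_lt|] h; first by move=> e e0; exact: h.
apply/cvgrPdist_lt => e /h; apply: filterS => n.
by rewrite sub0r normrN ger0_norm ?mdist_ge0.
Qed.

Lemma seq_to_infinityP x : seq_to_infinity x <->
  forall w A, \forall n \near \oo, A < mdist (x n) w.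
Proof. by split=> h w; apply/cvgryPgt; exact: h. Qed.

Lemma boundary_dist_le_mdist x p : metric_boundary C p ->
  boundary_dist C x <= mdist (to_completion C x) p.
Proof.
by move=> pb; apply: ge_inf; [exists 0 => _ [q _ <-]; exact: mdist_ge0|exists p].
Qed.

Lemma hsum_lt_of_near_boundary (p : C) (e : R) (x y : X) : metric_boundary C p ->
  mdist (to_completion C x) p < e / 4 -> mdist (to_completion C y) p < e / 4 ->
  hsum C x y < e.
Proof.
move=> pb xp yp.
have := boundary_dist_le_mdist x pb; have := boundary_dist_le_mdist y pb.
have /= := metric_triangle (to_completion C x) p (to_completion C y).
rewrite to_completion_isometry (metric_sym p) /hsum.
by lra.
Qed.

Lemma mdist_le_hsum x y : mdist x y <= hsum C x y.
Proof. by have := D_gt0 x; have := D_gt0 y; rewrite /hsum /D; lra. Qed.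

Lemma seq_to_point_bounded p x w : seq_to_point p x ->
  exists M, \forall n \near \oo, hsum C (x n) w <= M.
Proof.
move=> /seq_to_pointP/(_ 1 ltr01) h.
exists (2 * (1 + mdist p (to_completion C w)) + 2 * D w).
apply: filterS h => n h; apply: le_trans (hsum_le inc _ _) _.
rewrite lerD2r ler_pM2l// -(to_completion_isometry C).
by apply: le_trans (metric_triangle _ p _) _; rewrite lerD2r ltW.
Qed.

Lemma seq_to_point_gromov_seq p (x : nat -> Xj) : metric_boundary C p ->
  seq_to_point p x -> gromov_seq x.
Proof.
move=> pb /seq_to_pointP xp; apply/gromov_seqP => w A.
have [e e0 he] := gromov_prod_large_of_close lc inc w A.
have /xp[N _ hN] : 0 < e / 4 by rewrite divr_gt0.
exists N => i j iN jN; apply: he.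
by apply: hsum_lt_of_near_boundary pb _ _; exact: hN.
Qed.

Lemma seq_to_infinity_gromov_seq (x : nat -> Xj) :
  seq_to_infinity x -> gromov_seq x.
Proof.
move=> /seq_to_infinityP xp; apply/gromov_seqP => w A.
have [B hB] := gromov_prod_large_of_far lc inc w A.
have [N _ hN] := xp w B.
by exists N => i j iN jN; apply: hB;
  apply: le_trans (mdist_le_hsum _ _); exact/ltW/hN.
Qed.

Lemma seq_to_point_gromov_equiv p (x y : nat -> Xj) : metric_boundary C p ->
  seq_to_point p x -> seq_to_point p y -> gromov_equiv x y.
Proof.
move=> pb /seq_to_pointP xp /seq_to_pointP yp w; apply/cvgryPgt => A.
have [e e0 he] := gromov_prod_large_of_close lc inc w A.
have e4 : 0 < e / 4 by rewrite divr_gt0.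
have := yp _ e4; apply: filterS2 (xp _ e4) => n xn yn.
by apply: he; exact: hsum_lt_of_near_boundary pb _ _.
Qed.

Lemma seq_to_infinity_gromov_equiv (x y : nat -> Xj) :
  seq_to_infinity x -> seq_to_infinity y -> gromov_equiv x y.
Proof.
move=> /seq_to_infinityP xp /seq_to_infinityP yp w; apply/cvgryPgt => A.
have [B hB] := gromov_prod_large_of_far lc inc w A.
have := yp w B; apply: filterS2 (xp w B) => n xn yn; apply: hB;
  apply: le_trans (mdist_le_hsum _ _); exact/ltW.
Qed.

(** The terms of [x] stay bounded, so a large product forces [hsum C (y n) (x n)] to be small. *)
Lemma seq_to_point_of_gromov_equiv p (x y : nat -> Xj) :
  seq_to_point p x -> gromov_equiv x y -> seq_to_point p y.
Proof.
move=> xp xy; have [M hM] := seq_to_point_bounded (x 0) xp.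
apply/seq_to_pointP => e e0; have e2 : 0 < e / 2 by rewrite divr_gt0.
have [t t0 ht] := hsum_small_of_gromov_prod lc inc (x 0) M e2.
have /cvgryPgt/(_ t) := xy (x 0).
move: xp => /seq_to_pointP/(_ _ e2); apply: filterS3 hM => n xM xp xyt.
rewrite jtilde_gromov_prodC in xyt.
have /= := metric_triangle (to_completion C (y n)) (to_completion C (x n)) p.
have := mdist_le_hsum (y n) (x n).
by rewrite to_completion_isometry; have := ht _ _ xM xyt; lra.
Qed.

(** If [y n] were near [w] while [x n] is far away, [gromov_prod_bounded] would cap their
    product. *)
Lemma seq_to_infinity_of_gromov_equiv (x y : nat -> Xj) :
  seq_to_infinity x -> gromov_equiv x y -> seq_to_infinity y.
Proof.
move=> xp xy; apply/seq_to_infinityP => w A.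
have [t t0 ht] := gromov_prod_bounded lc inc w (2 * A + 2 * D w).
have /cvgryPgt/(_ t) := xy w.
move: xp => /seq_to_infinityP/(_ w (2 * (2 * A + 2 * D w))).
apply: filterS2 => n xn; rewrite ltNge jtilde_gromov_prodC; apply: contraNlt => yn.
apply: ht; last by apply: ltW (lt_le_trans xn (mdist_le_hsum _ _)).
by apply: le_trans (hsum_le inc _ _) _; rewrite lerD2r ler_pM2l.
Qed.

(** When the sequence does not tend to infinity, some ball is visited infinitely often. Comparing
    all late terms with one late term in that ball shows that the sequence is Cauchy. *)
Lemma gromov_seq_limit (x : nat -> Xj) : gromov_seq x ->
  (exists2 p, metric_boundary C p & seq_to_point p x) \/ seq_to_infinity x.
Proof.
move=> gx; have [?|] := pselect (seq_to_infinity x); first by right.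
move=> /seq_to_infinityP/existsNP[w /existsNP[A nA]]; left.
have xA N : exists2 n, (N <= n)%N & mdist (x n : X) w <= A.
  apply: contrapT => h; apply: nA; exists N => // n /= Nn.
  by rewrite ltNge; apply/negP => ?; apply: h; exists n.
have small (e : R) : 0 < e ->
    exists i N, forall j, (N <= j)%N -> hsum C (x j) (x i) < e.
  move=> e0.
  have [t t0 ht] := hsum_small_of_gromov_prod lc inc w (2 * A + 2 * D w) e0.
  have /gromov_seqP/(_ w t)[N hN] := gx.
  have [i Ni xi] := xA N; exists i, N => j Nj; apply: ht; last exact: hN.
  by apply: le_trans (hsum_le inc _ _) _; rewrite lerD2r ler_pM2l.
have xc : cauchy (to_completion C \o x @ \oo).
  apply/cauchy_ballP => e e0; have /small[i [N hN]] : 0 < e / 2 by rewrite divr_gt0.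
  exists ((to_completion C \o x) @` [set n | (N <= n)%N],
          (to_completion C \o x) @` [set n | (N <= n)%N]).
    by split; exists N => // n Nn /=; exists n.
  move=> [_ _] /= [[m Nm <-] [n Nn <-]]; rewrite ballEmdist/= to_completion_isometry.
  have /= := metric_triangle (x m : X) (x i) (x n); rewrite (metric_sym (x i : X)).
  have := hN _ Nm; have := hN _ Nn.
  by have := mdist_le_hsum (x m) (x i); have := mdist_le_hsum (x n) (x i); lra.
have [p _ /cvg_ballP xp] := completion_complete (fun _ => I) xc.
have {}xp : seq_to_point p x.
  apply/seq_to_pointP => e /xp; apply: filterS => n.
  by rewrite ballEmdist/= metric_sym.
exists p => // -[y _ yp].
(* A limit [y] in [X] is impossible: late terms satisfy [D (x n) < D y / 2] by [small], and
   [mdist y (x n) < D y / 2], against the Lipschitz bound for [D]. *)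
have Dy2 : 0 < D y / 2 by rewrite divr_gt0.
have [i [N hN]] := small _ Dy2.
move: xp => /seq_to_pointP/(_ _ Dy2)[N' _ hN'].
have := hN' _ (leq_maxr N N'); have := hN _ (leq_maxl N N').
rewrite -yp to_completion_isometry; set n := maxn N N'.
have := boundary_dist_le inc y (x n); rewrite (metric_sym y).
have := mdist_ge0 (x n : X) (x i); have := D_gt0 (x i).
by rewrite /hsum /D; lra.
Qed.

Lemma seq_to_point_inj p q x :
  seq_to_point p x -> seq_to_point q x -> p = q.
Proof.
move=> /seq_to_pointP xp /seq_to_pointP xq; apply/eqP/negPn/negP => pq.
have e0 : 0 < mdist p q / 2 by rewrite divr_gt0// mdist_gt0.
have [n [xpn xqn]] := filter_ex (filterI (xp _ e0) (xq _ e0)).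
have /= := metric_triangle p (to_completion C (x n)) q.
by rewrite (metric_sym p (to_completion C (x n))); lra.
Qed.

Lemma seq_to_point_infinity p x : seq_to_point p x -> ~ seq_to_infinity x.
Proof.
move=> xp /seq_to_infinityP xoo; have [M hM] := seq_to_point_bounded (x 0) xp.
have [n [xM]] := filter_ex (filterI hM (xoo (x 0) M)).
by apply/negP; rewrite -leNgt (le_trans (mdist_le_hsum _ _)).
Qed.

(** * The Gromov boundary described by limits of sequences *)

(** Equality of sets, rather than the existence of one representative, lets the infima over all
    representatives be computed from the limit alone. *)
Lemma gromov_boundary_cases (zeta : gromov_boundary Xj) :
  (exists2 p, metric_boundary C p & val zeta = seq_to_point p) \/
  val zeta = seq_to_infinity.
Proof.
have [x gx <-] := set_valP zeta; have [[p pb xp]|xoo] := gromov_seq_limit gx.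
  left; exists p => //; apply/seteqP; split=> y /=.
    by move=> [_]; exact: seq_to_point_of_gromov_equiv.
  move=> yp; split; first exact: seq_to_point_gromov_seq yp.
  exact: seq_to_point_gromov_equiv yp.
right; apply/seteqP; split=> y /=.
  by move=> [_]; exact: seq_to_infinity_of_gromov_equiv.
move=> yoo; split; first exact: seq_to_infinity_gromov_seq.
exact: seq_to_infinity_gromov_equiv.
Qed.

Lemma seq_to_point_neq0 p : seq_to_point p !=set0.
Proof.
have pc : closure (range (to_completion C)) p by rewrite to_completion_dense.
have /choice[u us] n : exists y, mdist p (to_completion C y) < n.+1%:R^-1.
  have n0 : 0 < n.+1%:R^-1 :> R by rewrite invr_gt0.
  have [_ [[y _ <-]]] := pc _ (nbhsx_ballx p _ n0).
  by rewrite ballEmdist => ?; exists y.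
exists u; apply/seq_to_pointP => e e0.
have := near_infty_natSinv_lt (PosNum e0); apply: filterS => n /=.
by rewrite metric_sym; exact: lt_trans.
Qed.

Lemma seq_to_infinity_neq0 : ~ metric_bounded [set: X] -> seq_to_infinity !=set0.
Proof.
move=> ub; have [p _] := inc; have [v _] := seq_to_point_neq0 p.
have /choice[u us] (n : nat) : exists y, n%:R < mdist y (v 0%N).
  apply: contrapT => h; apply: ub; exists (n%:R + n%:R) => x y _ _.
  have b z : mdist z (v 0%N) <= n%:R.
    by rewrite leNgt; apply/negP => hz; apply: h; exists z.
  apply: le_trans (metric_triangle _ (v 0%N) _) _.
  by rewrite (metric_sym (v 0%N)) lerD.
exists u; apply/seq_to_infinityP => w A.
have := nbhs_infty_ger (A + mdist w (v 0%N)); apply: filterS => n /= An.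
have /= := metric_triangle (u n) w (v 0%N); have := us n; lra.
Qed.

Lemma gromov_boundary_of_point p : metric_boundary C p ->
  exists zeta : gromov_boundary Xj, val zeta = seq_to_point p.
Proof.
move=> pb; have [x xp] := seq_to_point_neq0 p.
have gx : @gromov_seq R Xj x by exact: seq_to_point_gromov_seq xp.
pose s : set (nat -> Xj) := [set y | gromov_seq y /\ gromov_equiv (x : nat -> Xj) y].
have sb : s \in gromov_boundary Xj by apply/mem_set; exists x.
exists (SigSub sb); apply/seteqP; split=> y /=.
  by move=> [_]; exact: seq_to_point_of_gromov_equiv.
move=> yp; split; first exact: seq_to_point_gromov_seq yp.
exact: seq_to_point_gromov_equiv yp.
Qed.

Lemma gromov_boundary_infinity : ~ metric_bounded [set: X] ->
  exists zeta : gromov_boundary Xj, val zeta = seq_to_infinity.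
Proof.
move=> /seq_to_infinity_neq0[x xoo].
have gx : @gromov_seq R Xj x by exact: seq_to_infinity_gromov_seq xoo.
pose s : set (nat -> Xj) := [set y | gromov_seq y /\ gromov_equiv (x : nat -> Xj) y].
have sb : s \in gromov_boundary Xj by apply/mem_set; exists x.
exists (SigSub sb); apply/seteqP; split=> y /=.
  by move=> [_]; exact: seq_to_infinity_of_gromov_equiv.
move=> yoo; split; first exact: seq_to_infinity_gromov_seq.
exact: seq_to_infinity_gromov_equiv.
Qed.

End BoundarySequences.

Lemma lt_limn_einf (R : realType) (u : nat -> R) (t : R) :
  (t%:E < limn_einf (fun n => (u n)%:E))%E -> \forall n \near \oo, t < u n.
Proof.
rewrite limn_einf_lim (cvg_lim _ (@cvg_einfs_sup _ _))// => /ereal_sup_gt[_ [N _ <-]].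
move=> tN; exists N => // n /= Nn; rewrite -lte_fin; apply: (lt_le_trans tN).
by apply: ereal_inf_lbound; exists n.
Qed.

(** * The natural map *)

Section Naturality.
Context {R : realType} (X : metricType R) (C : completion X).
Context (lc : locally_complete X) (inc : metric_boundary C !=set0).

Let Xj : metricType R := jtilde_space lc inc.
Let D (x : X) : R := boundary_dist C x.
Let D_gt0 x : 0 < D x. Proof. exact: boundary_dist_gt0. Qed.

(** The limit point is picked by choice; by [gromov_boundary_cases] the value [None] is left for the
    class of sequences tending to infinity. *)
Definition jtilde_boundary_map (zeta : gromov_boundary Xj) :
    option (metric_boundary C) :=
  if pselect (exists p : metric_boundary C, val zeta = seq_to_point (val p))
  is left h then Some (projT1 (cid h)) else None.

Lemma jtilde_boundary_mapP zeta :
  if jtilde_boundary_map zeta is Some p then val zeta = seq_to_point (val p)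
  else val zeta = @seq_to_infinity R X.
Proof.
rewrite /jtilde_boundary_map; case: pselect => [h|nh]; first by case: (cid h).
have [[p pb zp]|//] := gromov_boundary_cases zeta.
by case: nh; exists (SigSub (mem_set pb)).
Qed.

Lemma gromov_boundary_neq0 (zeta : gromov_boundary Xj) : val zeta !=set0.
Proof.
have [x gx <-] := set_valP zeta; exists x; split=> // w.
apply/cvgryPgt => A; have /gromov_seqP/(_ w A)[N hN] := gx.
by exists N => // n Nn; exact: hN.
Qed.

(** Points of [X] count as constant sequences, so that both kinds of points of the bordification are
    treated at once. *)
Let approximates (x : nat -> X) (z : bordification Xj) :=
  match z with inl x0 => x = cst x0 | inr xi => val xi x end.

(** The product is an infimum over all representatives, so any chosen ones already exceed [t] from
    some index on. *)
Lemma lt_bordification_prod (t : R) (w : Xj) z zeta :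
  (t%:E < bordification_prod w z zeta)%E ->
  exists x y, [/\ approximates x z, val zeta y &
    \forall n \near \oo, t < @gromov_prod R Xj w (x n) (y n)].
Proof.
have [y zy] := gromov_boundary_neq0 zeta; case: z => [x0|xi] /=.
  move=> h; exists (cst x0), y; split=> //; apply: lt_limn_einf.
  by apply: (lt_le_trans h); apply: ereal_inf_lbound; exists y.
have [x xx] := gromov_boundary_neq0 xi.
move=> h; exists x, y; split=> //; apply: lt_limn_einf.
by apply: (lt_le_trans h); apply: ereal_inf_lbound; exists x => //; exists y.
Qed.

Let ext := extension_map (fun x : Xj => x : X) jtilde_boundary_map.

Let ext_limit x z : approximates x z ->
  match ext z with Some c => seq_to_point c x | None => seq_to_infinity x end.
Proof.
rewrite /ext; case: z => [x0 /= ->|xi /=].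
  by apply/seq_to_pointP => e e0; apply: nearW => n; rewrite mdistxx.
by have := jtilde_boundary_mapP xi; case: jtilde_boundary_map => [p|] /= ->.
Qed.

(** The second factor in the logarithm is at least [1], so [jtilde C x y] is at least
    [2^-1 * ln (1 + mdist x y / D x)]; this dictates the radius. *)
Lemma open_jtilde (A : set X) : open A -> open (A : set Xj).
Proof.
rewrite !openE => oA x /oA /nbhs_ballP[e /= e0 eA].
apply/nbhs_ballP; exists (2^-1 * ln (1 + e / D x)) => /=.
  by rewrite mulr_gt0 ?invr_gt0// ln_gt0// ltrDl divr_gt0.
move=> y; rewrite ballEmdist /= mdist_jtildeE /jtilde ltr_pM2l ?invr_gt0// => h.
apply: eA; rewrite ballEmdist /=.
have dx0 : 0 <= mdist (x : X) y / D x by rewrite divr_ge0 ?mdist_ge0// ltW.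
have dy0 : 0 <= mdist (x : X) y / D y by rewrite divr_ge0 ?mdist_ge0// ltW.
have e0' : 0 < e / D x by rewrite divr_gt0.
have p1 (s : R) : 0 <= s -> 0 < 1 + s by move=> s0; rewrite ltr_pwDl.
move: h; rewrite ltr_ln ?posrE; last first.
- exact/p1/ltW.
- by rewrite mulr_gt0// p1.
move=> h.
rewrite -(@ltr_pM2r _ (D x)^-1) ?invr_gt0// -(ltrD2l 1).
by apply: le_lt_trans h; rewrite ler_peMr ?lerDl// ltW// p1.
Qed.

Lemma jtilde_boundary_map_natural :
  natural_map (fun x : Xj => x : X) jtilde_boundary_map.
Proof.
apply/continuousP => A [oA bA]; split.
  have -> : [set x : Xj | (ext @^-1` A) (inl x)] =
    to_completion C @^-1` [set y | A (Some y)] by [].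
  apply: open_jtilde; rewrite openE => x /= Ax.
  move: oA; rewrite openE => /(_ _ Ax) /nbhs_ballP[e /= e0 eA].
  apply/nbhs_ballP; exists e => // y; rewrite ballEmdist/= => xy.
  by apply: eA; rewrite ballEmdist/= to_completion_isometry.
move=> zeta Az w; have := jtilde_boundary_mapP zeta.
move: Az; rewrite /= /extension_map; case: jtilde_boundary_map => [p|] /= Ap zp.
  (* Near a boundary point [p], a large product with a sequence [y] tending to [p] forces the
     sequence [x] approximating [z] close to [y]. The thirds of [e] pay for the steps from [p] to
     [y n], from [y n] to [x n], and from [x n] to its limit [c]. *)
  move: oA; rewrite openE => /(_ _ Ap) /nbhs_ballP[e /= e0 eA].
  have e3 : 0 < e / 3 by rewrite divr_gt0.
  have [y0 y0p] := seq_to_point_neq0 (val p).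
  have [M hM] : exists M, forall y, seq_to_point (val p) y ->
      \forall n \near \oo, hsum C (y n) w <= M.
    exists (2 * (1 + mdist (val p) (to_completion C w)) + 2 * D w) => y.
    move=> /seq_to_pointP/(_ 1 ltr01); apply: filterS => n h.
    apply: le_trans (hsum_le inc _ _) _.
    rewrite lerD2r ler_pM2l// -(to_completion_isometry C).
    by apply: le_trans (metric_triangle _ (val p) _) _; rewrite lerD2r ltW.
  have [t t0 ht] := hsum_small_of_gromov_prod lc inc w M e3.
  exists t => // z /lt_bordification_prod[x [y [xz zy xy]]].
  have yp : seq_to_point (val p) y by rewrite -zp.
  change (A (ext z)); have := ext_limit xz; case: (ext z) => [c xc|xoo].
    apply: eA; rewrite ballEmdist /=.
    have xc3 := (seq_to_pointP _ _).1 xc _ e3.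
    have yp3 := (seq_to_pointP _ _).1 yp _ e3.
    have [n [[xn yn] [xyn yM]]] :=
      filter_ex (filterI (filterI xc3 yp3) (filterI xy (hM _ yp))).
    have := ht _ _ yM xyn; have := mdist_le_hsum lc inc (x n) (y n).
    have /= := metric_triangle (val p) (to_completion C (y n)) c.
    have /= := metric_triangle (to_completion C (y n)) (to_completion C (x n)) c.
    rewrite (metric_sym (val p) (to_completion C (y n))) to_completion_isometry.
    rewrite (@metric_sym _ X (y n)).
    by move: xn yn; lra.
  (* The image of [z] is not infinity, since [x n] stays close to the bounded [y n]. *)
  exfalso.
  have xb : \forall n \near \oo, hsum C (x n) w < e / 3 + M.
    apply: filterS2 xy (hM _ yp) => n xyn yM.
    apply: le_lt_trans (hsum_triangle lc inc (y n) _ _) _.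
    by rewrite ltr_leD// ht.
  have [n [xn]] := filter_ex (filterI xb ((seq_to_infinityP _).1 xoo w (e / 3 + M))).
  by apply/negP; rewrite -leNgt (le_trans (mdist_le_hsum lc inc _ _))// ltW.
(* Near infinity, a point mapped outside [A] lands in a bounded set, and its product with a sequence
   tending to infinity is bounded. *)
have [M hM] := bA Ap.
have [B hB] : exists B, forall c, ~ A (Some c) -> mdist c (to_completion C w) <= B.
  have [[c0 nc0]|nA] := pselect (exists c, ~ A (Some c)).
    exists (M + mdist c0 (to_completion C w)) => c nc.
    by apply: le_trans (metric_triangle _ c0 _) _; rewrite lerD2r hM.
  by exists 0 => c nc; case: nA; exists c.
(* This bounds [hsum C (x n) w] once [x n] is within [1] of a limit [c] outside [A]. *)
set N := 2 * (1 + B) + 2 * D w.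
have [t t0 ht] := gromov_prod_bounded lc inc w N.
exists t => // z /lt_bordification_prod[x [y [xz zy xy]]].
have yoo : @seq_to_infinity R X y by rewrite -zp.
change (A (ext z)); apply: contrapT => nAz; have := ext_limit xz.
move: nAz; case: (ext z) => [c nc xc|//].
have xN : \forall n \near \oo, hsum C (x n) w <= N.
  have := (seq_to_pointP _ _).1 xc _ ltr01; apply: filterS => n xn.
  apply: le_trans (hsum_le inc _ _) _.
  rewrite lerD2r ler_pM2l// -(to_completion_isometry C).
  by apply: le_trans (metric_triangle _ c _) _; rewrite lerD ?hB// ltW.
have yN := (seq_to_infinityP _).1 yoo w (2 * N).
have [n [[xn yn] xyn]] := filter_ex (filterI (filterI xN yN) xy).
move: xyn; apply/negP; rewrite -leNgt; apply: ht => //.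
exact: le_trans (ltW yn) (mdist_le_hsum lc inc _ _).
Qed.

End Naturality.

Lemma cvg_ratio1 (R : realType) (u v : nat -> R) (K : R) :
  (forall n, `|u n - v n| <= K) -> v @ \oo --> +oo ->
  u n / v n @[n --> \oo] --> (1 : R).
Proof.
move=> uvK /cvgryPgt voo; apply/cvgrPdist_lt => e e0.
apply: filterS2 (voo 0) (voo (K / e)) => n v0 vK.
have -> : 1 - u n / v n = - (u n - v n) / v n by field; rewrite gt_eqF.
rewrite normrM normrN normfV (gtr0_norm v0) ltr_pdivrMr//.
by apply: le_lt_trans (uvK n) _; rewrite mulrC -ltr_pdivrMr.
Qed.

Lemma ereal_inf_image_cst (R : realType) (T : Type) (A : set T) (f : T -> \bar R) c :
  A !=set0 -> (forall x, A x -> f x = c) -> ereal_inf (f @` A) = c.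
Proof.
move=> [x Ax] fc; rewrite (_ : f @` A = [set c]) ?ereal_inf1//.
by apply/seteqP; split=> [_ [y Ay <-]|_ ->]; [exact: fc|exists x => //; exact: fc].
Qed.

(** * Busemann functions based at infinity *)

Section BusemannFunctions.
Context {R : realType} (X : metricType R) (C : completion X).
Context (lc : locally_complete X) (inc : metric_boundary C !=set0).

Let Xj : metricType R := jtilde_space lc inc.
Let D (x : X) : R := boundary_dist C x.
Let D_gt0 x : 0 < D x. Proof. exact: boundary_dist_gt0. Qed.

(** In each of the two factors, numerator and denominator differ by a bounded amount while the
    denominator tends to infinity; in the second factor [D (y n)], however large, cancels from the
    difference. *)
Lemma hprod_ratio_cvg (w x : X) (y : nat -> X) : seq_to_infinity y ->
  hprod C w (y n) / hprod C x (y n) @[n --> \oo] --> (1 : R).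
Proof.
move=> yoo.
have dd n : `|mdist w (y n) - mdist x (y n)| <= mdist w x.
  have /= := metric_triangle w x (y n); have /= := metric_triangle x w (y n).
  by rewrite (metric_sym x w) ler_norml => ? ?; apply/andP; split; lra.
have doo : mdist x (y n) @[n --> \oo] --> +oo.
  by apply/cvgryPgt => A; have /cvgryPgt/(_ A) := yoo x; apply: filterS => n;
    rewrite metric_sym.
have r1 : (D w + mdist w (y n)) / (D x + mdist x (y n)) @[n --> \oo] --> (1 : R).
  apply: (@cvg_ratio1 _ _ _ (mdist w x + (D w + D x))).
    move=> n; have := dd n; have := D_gt0 x; have := D_gt0 w.
    by rewrite !ler_norml => ? ? /andP[? ?]; apply/andP; split; lra.
  apply/cvgryPgt => A; have /cvgryPgt/(_ A) := doo; apply: filterS => n.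
  by have := D_gt0 x; lra.
have r2 : (D (y n) + mdist w (y n)) / (D (y n) + mdist x (y n))
    @[n --> \oo] --> (1 : R).
  apply: (@cvg_ratio1 _ _ _ (mdist w x)).
    by move=> n; rewrite opprD addrACA subrr add0r.
  apply/cvgryPgt => A; have /cvgryPgt/(_ A) := doo; apply: filterS => n.
  by have := D_gt0 (y n); lra.
have -> : (fun n => hprod C w (y n) / hprod C x (y n)) =
    (fun n => (D w + mdist w (y n)) / (D x + mdist x (y n)) *
              ((D (y n) + mdist w (y n)) / (D (y n) + mdist x (y n)))).
  by apply/funext => n; rewrite mulf_div.
by rewrite -[X in _ --> X]mulr1; exact: cvgM.
Qed.

Lemma gromov_prod_cvg_infinity (w x : X) (y : nat -> X) : seq_to_infinity y ->
  @gromov_prod R Xj w x (y n) @[n --> \oo] -->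
  4^-1 * ln (hprod C x w / boundary_dist C w ^+ 2).
Proof.
move=> yoo; have h := hprod_gt0 lc inc.
have c0 : 0 < hprod C x w / D w ^+ 2 by rewrite divr_gt0// exprn_gt0.
have : hprod C x w / D w ^+ 2 * (hprod C w (y n) / hprod C x (y n))
    @[n --> \oo] --> hprod C x w / D w ^+ 2.
  rewrite -[X in _ --> X]mulr1; apply: cvgM; first exact: cvg_cst.
  exact: hprod_ratio_cvg.
move=> /(continuous_cvg _ (continuous_ln c0)) hl.
have -> : (fun n => @gromov_prod R Xj w x (y n)) = (fun n => 4^-1 *
    ln (hprod C x w / D w ^+ 2 * (hprod C w (y n) / hprod C x (y n)))).
  apply/funext => n; rewrite gromov_prodE (hprodC _ (y n) w); congr (_ * ln _).
  have := h x (y n); have := D_gt0 w; rewrite /D => *.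
  by field; rewrite !gt_eqF.
by apply: cvgM; first exact: cvg_cst.
Qed.

Context (xi : gromov_boundary Xj) (xiE : val xi = @seq_to_infinity R X).

(** All representatives give the same genuine limit, which is therefore the infimum of the lower
    limits. *)
Lemma gromov_prod_pb_infinity (w x : Xj) : gromov_prod_pb w x xi =
  (4^-1 * ln (hprod C x w / boundary_dist C w ^+ 2))%:E.
Proof.
apply: ereal_inf_image_cst => [|y]; first exact: gromov_boundary_neq0.
rewrite xiE => yoo; apply: (cvg_limn_einf_sup _).1.
apply: cvg_EFin; first exact: nearW.
exact: gromov_prod_cvg_infinity.
Qed.

Lemma busemann_jtildeE (w x : Xj) :
  busemann xi w x = 2^-1 * ln (boundary_dist C w / boundary_dist C x).
Proof.
rewrite /busemann !gromov_prod_pb_infinity (hprodC C w x).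
have := hprod_gt0 lc inc x w; have := D_gt0 x; have := D_gt0 w; rewrite /D.
move: (hprod C x w) (boundary_dist C x) (boundary_dist C w) => p a b * /=.
by rewrite !(ln_div, lnM, expr2) ?posrE ?mulr_gt0//; field.
Qed.

Lemma busemann_prod_jtildeE (w x y : Xj) : busemann_prod (busemann xi w) x y =
  4^-1 * ln (boundary_dist C w ^+ 2 / hprod C x y).
Proof.
rewrite /busemann_prod !busemann_jtildeE mdist_jtildeE (jtildeE lc inc).
have := hprod_gt0 lc inc x y; have := D_gt0 x; have := D_gt0 w; have := D_gt0 y.
rewrite /D; move: (hprod C x y) => p.
move: (boundary_dist C x) (boundary_dist C y) (boundary_dist C w) => a b c *.
by rewrite !(ln_div, lnM, expr2) ?posrE ?mulr_gt0//; field.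
Qed.

Lemma hprod_cvg_boundary (p q : C) (x y : nat -> X) :
  metric_boundary C p -> metric_boundary C q ->
  seq_to_point p x -> seq_to_point q y ->
  hprod C (x n) (y n) @[n --> \oo] --> mdist p q ^+ 2.
Proof.
move=> pb qb xp yq.
have D0 r z : metric_boundary C r -> seq_to_point r z ->
    D (z n) @[n --> \oo] --> (0 : R).
  move=> rb /seq_to_pointP zr; apply/cvgrPdist_lt => e /zr; apply: filterS => n.
  rewrite sub0r normrN gtr0_norm//; apply: le_lt_trans.
  exact: boundary_dist_le_mdist.
have d0 : mdist (x n) (y n) @[n --> \oo] --> mdist p q.
  apply/cvgrPdist_lt => e e0; have e2 : 0 < e / 2 by rewrite divr_gt0.
  apply: filterS2 ((seq_to_pointP _ _).1 xp _ e2) ((seq_to_pointP _ _).1 yq _ e2).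
  move=> n xn yn; rewrite -(to_completion_isometry C).
  move: (to_completion C (x n)) (to_completion C (y n)) xn yn => a b xn yn.
  have /= := metric_triangle p a q; have /= := metric_triangle a b q.
  have /= := metric_triangle a p b; have /= := metric_triangle p q b.
  rewrite (metric_sym p a) (metric_sym q b) ltr_norml => *.
  by apply/andP; split; lra.
have -> : mdist p q ^+ 2 = (0 + mdist p q) * (0 + mdist p q).
  by rewrite add0r expr2.
exact: cvgM (cvgD (D0 _ _ pb xp) d0) (cvgD (D0 _ _ qb yq) d0).
Qed.

Lemma busemann_prod_bb_jtildeE (w : Xj) (p q : C) (z1 z2 : gromov_boundary Xj) :
  metric_boundary C p -> metric_boundary C q ->
  val z1 = seq_to_point p -> val z2 = seq_to_point q ->
  busemann_prod_bb (busemann xi w) z1 z2 =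
  if p == q then +oo%E else (2^-1 * ln (boundary_dist C w / mdist p q))%:E.
Proof.
move=> pb qb z1p z2q; rewrite /busemann_prod_bb.
have [x zx] := gromov_boundary_neq0 z1; have [y zy] := gromov_boundary_neq0 z2.
set c := (X in _ = X).
suff h x' y' : val z1 x' -> val z2 y' ->
    limn_einf (fun i => (busemann_prod (busemann xi w) (x' i) (y' i))%:E) = c.
  rewrite (_ : [set _ | _ in _ & _ in _] = [set c]) ?ereal_inf1//.
  apply/seteqP; split=> [_ [x' x'z [y' y'z <-]]|_ ->]; first exact: h.
  by exists x => //; exists y => //; exact: h.
rewrite z1p z2q => xp yq.
have pqc := hprod_cvg_boundary pb qb xp yq.
have h := hprod_gt0 lc inc; have Dw : 0 < D w ^+ 2 by rewrite exprn_gt0.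
apply: (cvg_limn_einf_sup _).1; rewrite {}/c; case: eqP => [pq|/eqP pq].
  (* For [p = q] the quantity [hprod] tends to [0], so the logarithm exceeds every [A]. *)
  apply/cvgeryP/cvgryPgt => A; rewrite pq mdistxx expr0n /= in pqc.
  have /(cvgr_lt _ pqc) : 0 < D w ^+ 2 / expR (4 * A) by rewrite divr_gt0 ?expR_gt0.
  apply: filterS => n hA; rewrite busemann_prod_jtildeE ltr_pdivlMl//.
  rewrite -[ltLHS]expRK ltr_ln ?posrE ?expR_gt0 ?divr_gt0//.
  rewrite ltr_pdivlMr// mulrC -ltr_pdivlMr ?expR_gt0//.
have d0 : 0 < mdist p q by rewrite mdist_gt0.
apply: cvg_EFin; first exact: nearW.
rewrite (_ : _ \o _ = fun n => 4^-1 * ln (D w ^+ 2 / hprod C (x' n) (y' n)));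
  last first.
  by apply/funext => n /=; rewrite busemann_prod_jtildeE.
have -> : 2^-1 * ln (D w / mdist p q) = 4^-1 * ln (D w ^+ 2 / mdist p q ^+ 2).
  by rewrite -expr_div_n lnXn ?divr_gt0// -mulr_natl; field.
apply: cvgM; first exact: cvg_cst.
apply: continuous_cvg; first by apply: continuous_ln; rewrite divr_gt0 ?exprn_gt0.
apply: cvgM; first exact: cvg_cst.
by apply: cvgV => //; rewrite gt_eqF// exprn_gt0.
Qed.

Lemma hamenstadt_rho_jtildeE (eps : R) (w : Xj) (p q : C)
    (z1 z2 : gromov_boundary Xj) : 0 < eps ->
  metric_boundary C p -> metric_boundary C q ->
  val z1 = seq_to_point p -> val z2 = seq_to_point q ->
  hamenstadt_rho (busemann xi w) eps z1 z2 =
  (mdist p q / boundary_dist C w) `^ (eps / 2).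
Proof.
move=> e0 pb qb z1p z2q; rewrite /hamenstadt_rho.
rewrite (busemann_prod_bb_jtildeE w pb qb)//.
case: eqP => [->|/eqP pq].
  (* For [p = q] both sides vanish: the exponential of [-oo] on the left, a positive power of [0] on
     the right. *)
  rewrite mdistxx mul0r powR0; last by rewrite gt_eqF// divr_gt0.
  by rewrite gt0_muley// lte_fin.
have d0 : 0 < mdist p q by rewrite mdist_gt0.
have Dw := D_gt0 w; rewrite /D in Dw.
rewrite /= /powR gt_eqF ?divr_gt0//; congr expR.
by rewrite !ln_div ?posrE//; field.
Qed.

End BusemannFunctions.

(** * The quasi-ultrametric inequality on the metric boundary *)

Section BoundaryQuasiUltrametric.
Context {R : realType} (X : metricType R) (C : completion X).
Context (unbounded : ~ metric_bounded [set: X]).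
Context (lc : locally_complete X) (inc : metric_boundary C !=set0).

Let Xj : metricType R := jtilde_space lc inc.
Context (delta : R) (hyp : hyperbolic Xj delta).

Lemma hprod_le_of_hyperbolic (z x y : X) :
  hprod C x y <= expR (4 * delta) * hprod C x z \/
  hprod C x y <= expR (4 * delta) * hprod C z y.
Proof.
have h := hprod_gt0 lc inc; have [v voo] := seq_to_infinity_neq0 inc unbounded.
have K4 : expR (4 * delta) = expR delta ^+ 4 by rewrite expRM_natl.
have hK := hyp; rewrite -[delta]expRK jtilde_hyperbolicP ?expR_gt0// in hK.
(* The negated conclusion is a pair of strict inequalities. Since the ratios with [v n] tend to [1],
   both persist at some finite [n], where they contradict the four-point inequality. *)
apply: contrapT => /not_orP[/negP]; rewrite -ltNge => l1 /negP; rewrite -ltNge => l2.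
have r (c : R) u : c * (hprod C u (v n) / hprod C z (v n)) @[n --> \oo] --> c.
  rewrite -[X in _ --> X]mulr1; apply: cvgM; first exact: cvg_cst.
  exact: hprod_ratio_cvg.
have [n [/= h1 h2]] :=
  filter_ex (filterI (cvgr_lt _ (r _ y) _ l1) (cvgr_lt _ (r _ x) _ l2)).
rewrite mulrA ltr_pdivrMr// -mulrA in h1; rewrite mulrA ltr_pdivrMr// -mulrA in h2.
have := hK x y z (v n); rewrite -K4 => -[] /le_lt_trans.
  by move=> /(_ _ h1); rewrite ltxx.
by move=> /(_ _ h2); rewrite ltxx.
Qed.

(** Along sequences tending to [p], [q] and [r], [hprod] becomes the squared distance; the square
    root halves the exponent [4 * delta]. *)
Lemma boundary_mdist_le_of_hyperbolic (r p q : C) :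
  metric_boundary C p -> metric_boundary C q -> metric_boundary C r ->
  mdist p q <= expR (2 * delta) * mdist p r \/
  mdist p q <= expR (2 * delta) * mdist r q.
Proof.
move=> pb qb rb.
have [x xp] := seq_to_point_neq0 p; have [y yq] := seq_to_point_neq0 q.
have [z zr] := seq_to_point_neq0 r.
have K4 : expR (4 * delta) = expR (2 * delta) ^+ 2.
  by rewrite -expRM_natl; congr expR; ring.
have sq a b : 0 <= a -> b ^+ 2 <= expR (4 * delta) * a ^+ 2 ->
    b <= expR (2 * delta) * a.
  move=> a0; rewrite K4 -exprMn => h.
  rewrite -(ger0_norm (mulr_ge0 (expR_ge0 _) a0)).
  apply: le_trans (ler_norm _) _.
  by rewrite -ler_sqr ?nnegrE// !real_normK ?num_real.
suff [h|h] : mdist p q ^+ 2 <= expR (4 * delta) * mdist p r ^+ 2 \/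
    mdist p q ^+ 2 <= expR (4 * delta) * mdist r q ^+ 2.
- by left; apply: sq => //; exact: mdist_ge0.
- by right; apply: sq => //; exact: mdist_ge0.
apply: contrapT => /not_orP[/negP]; rewrite -ltNge -subr_lt0 => l1.
move=> /negP; rewrite -ltNge -subr_lt0 => l2.
have cxy := hprod_cvg_boundary lc inc pb qb xp yq.
have lim (u : nat -> R) (a : R) : u n @[n --> \oo] --> a ->
    expR (4 * delta) * u n - hprod C (x n) (y n) @[n --> \oo] -->
    expR (4 * delta) * a - mdist p q ^+ 2.
  by move=> ua; apply: cvgB => //; exact: cvgMl_tmp.
have c1 := lim _ _ (hprod_cvg_boundary lc inc pb rb xp zr).
have c2 := lim _ _ (hprod_cvg_boundary lc inc rb qb zr yq).
have [n [/= h1 h2]] := filter_ex (filterI (cvgr_lt _ c1 _ l1) (cvgr_lt _ c2 _ l2)).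
rewrite subr_lt0 in h1; rewrite subr_lt0 in h2.
have [|] := hprod_le_of_hyperbolic (z n) (x n) (y n).
  by move=> /(lt_le_trans h1); rewrite ltxx.
by move=> /(lt_le_trans h2); rewrite ltxx.
Qed.

End BoundaryQuasiUltrametric.

(** * Frink's chain argument *)

(** A chain of total length [L] is cut at the link that crosses [L / 2]. By induction [rho] is at
    most [2 * (L / 2)] across each outer piece, the link itself is at most [L], and the three-step
    inequality with [M = L] concludes. *)
Lemma chain_ge (R : realType) (T : Type) (rho : T -> T -> R) :
  (forall x y, 0 <= rho x y) -> (forall x, rho x x = 0) ->
  (forall x z u y M, rho x z <= M -> rho z u <= M -> rho u y <= M ->
    rho x y <= 2 * M) ->
  forall (u : nat -> T) n, rho (u 0%N) (u n) <= 2 * \sum_(i < n) rho (u i) (u i.+1).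
Proof.
move=> rho0 rhoxx rho3 u.
pose s n : R := \sum_(i < n) rho (u i) (u i.+1).
have sS n : s n.+1 = s n + rho (u n) (u n.+1) by rewrite /s big_ord_recr.
have smono m n : (m <= n)%N -> s m <= s n.
  elim: n => [|n IH]; first by rewrite leqn0 => /eqP ->.
  rewrite leq_eqVlt => /predU1P[->//|]; rewrite ltnS => /IH mn.
  by rewrite sS (le_trans mn)// lerDl.
(* The right piece does not start at [0], so the induction covers all segments; [N] bounds the
   number of links. *)
suff key N a b : (a <= b)%N -> (b - a <= N)%N -> rho (u a) (u b) <= 2 * (s b - s a).
  by move=> n; have := key n 0%N n; rewrite subn0 [s 0%N]big_ord0 subr0; exact.
elim: N a b => [|N IH] a b ab; first by
  rewrite leqn0 subn_eq0 => ba; rewrite (@anti_leq a b) ?ab// rhoxx subrr mulr0.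
move=> baN; move: ab; rewrite leq_eqVlt => /predU1P[->|ab].
  by rewrite rhoxx subrr mulr0.
(* The link from [k] to [k.+1] crosses half of the total length. *)
pose P k := [&& (a <= k)%N, (k < b)%N & s k - s a <= (s b - s a) / 2].
have exP : exists k, P k.
  by exists a; rewrite /P leqnn ab subrr divr_ge0// subr_ge0 smono// ltnW.
have ubP k : P k -> (k <= b)%N by case/and3P => _ /ltnW.
case: (ex_maxnP exP ubP) => k /and3P[ak kb sk] kmax.
(* By maximality of [k], at most half of the length remains after [k.+1]; if [k.+1 = b], nothing
   remains. *)
have sbk : s b - s k.+1 <= (s b - s a) / 2.
  have [kb1|bk1] := ltnP k.+1 b.
    have : ~~ P k.+1 by apply/negP => /kmax; rewrite ltnn.
    by rewrite /P kb1 (leq_trans ak)//= -ltNge; lra.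
  rewrite (@anti_leq k.+1 b) ?bk1 ?kb// subrr divr_ge0// subr_ge0 smono//.
  exact: ltnW.
have := smono _ _ ak; have := smono _ _ kb => sk1 sak.
have sab := smono _ _ (ltnW ab).
apply: (rho3 _ (u k) (u k.+1)).
- apply: (le_trans (IH a k ak _)); last by lra.
  by rewrite -ltnS (leq_trans _ baN)// ltn_sub2r.
- by have := sS k; lra.
- apply: (le_trans (IH k.+1 b kb _)); last by lra.
  by rewrite -ltnS (leq_trans _ baN)// ltn_sub2l.
Qed.

(** * The power function controlling the quasisymmetry *)

Section PowerHomeomorphism.
Context {R : realType}.

Lemma powR_within_continuous (c r : R) : 0 < r ->
  {within `[0, +oo[, continuous (fun t : R => c * t `^ r)}.
Proof.
move=> r0; apply/continuous_within_itvcyP; split.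
  move=> t t0; apply: cvgMl_tmp.
  have : {for t, continuous (@powR R ^~ r)}.
    apply: differentiable_continuous.
    apply/derivable1_diffP.
    exact: derivable_powR.
  by [].
by rewrite powR0 ?gt_eqF//; apply: cvgMl_tmp; exact: powR_cvg0.
Qed.

(** For [t >= 0] this is [(2 t)^(2 / eps)], split as a constant times a power so that
    [powR_within_continuous] applies. *)
Definition quasisymmetry_bound (eps t : R) : R := 2 `^ (2 / eps) * t `^ (2 / eps).

Lemma quasisymmetry_bound_homeomorphism (eps : R) : 0 < eps ->
  homeomorphism_Rge0 (quasisymmetry_bound eps).
Proof.
(* The inverse [g] comes from solving [s = (2 t)^(2 / eps)] for [t]. *)
move=> e0; pose g (s : R) := 2^-1 * s `^ (eps / 2).
have a0 : 0 < 2 / eps by rewrite divr_gt0.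
have b0 : 0 < eps / 2 by rewrite divr_gt0.
have ab : 2 / eps * (eps / 2) = 1 by field; rewrite gt_eqF.
have ge0 (t : R) : (`[0, +oo[%classic t) = (0 <= t) by rewrite /= in_itv/= andbT.
have gK t : 0 <= t -> g (quasisymmetry_bound eps t) = t.
  move=> t0; rewrite /g /quasisymmetry_bound -powRM// -powRrM ab powRr1 ?mulr_ge0//.
  by rewrite mulKf.
have Kg s : 0 <= s -> quasisymmetry_bound eps (g s) = s.
  move=> s0; rewrite /g /quasisymmetry_bound -powRM ?mulr_ge0 ?powR_ge0//.
  by rewrite mulVKf// -powRrM mulrC ab powRr1.
have gfun : set_fun `[0, +oo[ `[0, +oo[ g.
  by move=> s; rewrite !ge0 => _; rewrite mulr_ge0// powR_ge0.
split.
- split.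
  + by move=> t; rewrite !ge0 => _; rewrite mulr_ge0 ?powR_ge0.
  + move=> s t /set_mem; rewrite ge0 => s0 /set_mem; rewrite ge0 => t0 st.
    by have := congr1 g st; rewrite !gK.
  + move=> s; rewrite ge0 => s0; exists (g s); last exact: Kg.
    by apply: gfun; rewrite ge0.
- exact: powR_within_continuous.
- exists g; split => //.
  + by move=> t; rewrite in_itv/= andbT => /gK.
  + exact: powR_within_continuous.
Qed.

End PowerHomeomorphism.

(** * Hamenstaedt metrics *)

Section HamenstadtQuasisymmetry.
Context {R : realType} (X : metricType R) (C : completion X).
Context (unbounded : ~ metric_bounded [set: X]).
Context (lc : locally_complete X) (inc : metric_boundary C !=set0).

Let Xj : metricType R := jtilde_space lc inc.
Let D (x : X) : R := boundary_dist C x.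
Let D_gt0 x : 0 < D x. Proof. exact: boundary_dist_gt0. Qed.

Context (xi : gromov_boundary Xj) (xiE : val xi = @seq_to_infinity R X).
Context (f : punctured_boundary xi -> metric_boundary C)
  (fE : forall z, val (val z) = seq_to_point (val (f z))).

Let bdry z : metric_boundary C (val (f z)). Proof. exact: set_valP. Qed.

Lemma punctured_boundary_bijective : bijective f.
Proof.
have finj : injective f.
  by move=> y z yz; apply/val_inj/val_inj; rewrite !fE yz.
have /choice[g gf] p : exists z, f z = p.
  have [zeta zp] := gromov_boundary_of_point lc inc (set_valP p).
  have [u up] := seq_to_point_neq0 (val p).
  (* A sequence converging to [p] does not tend to infinity, so its class differs from [xi]. *)
  have zxi : punctured_boundary xi zeta.
    move=> zx; apply: (seq_to_point_infinity lc inc up).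
    by rewrite -xiE -zx zp.
  exists (SigSub (mem_set zxi)); apply: val_inj.
  apply: (@seq_to_point_inj _ _ _ _ _ u) => //.
  by rewrite -fE /= zp.
by exists g => // z; apply: finj; rewrite gf.
Qed.

Context (delta eps : R) (w : Xj).
Context (hyp : hyperbolic Xj delta) (adm : admissible delta eps).

Let b := busemann xi w.
Let rho (y z : punctured_boundary xi) := hamenstadt_rho b eps (val y) (val z).

Let eps0 : 0 < eps. Proof. by case: adm. Qed.

Let rhoE y z : rho y z = (mdist (val (f y)) (val (f z)) / D w) `^ (eps / 2).
Proof.
exact: (hamenstadt_rho_jtildeE xiE w eps0 (@bdry y) (@bdry z) (fE y) (fE z)).
Qed.

(** Four equal points in the hyperbolicity inequality give this; it lets [22 * eps * delta] dominate
    smaller multiples. *)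
Let delta_ge0 : 0 <= delta.
Proof.
have := hyp w w w w; rewrite /gromov_prod !mdistxx.
by rewrite minxx; lra.
Qed.

Lemma hamenstadt_rho_ge0 y z : 0 <= rho y z.
Proof. by rewrite rhoE powR_ge0. Qed.

(** Two uses of the quasi-ultrametric inequality bound the distance of the endpoints by one of the
    three links times [e^(4 delta)]. The power [eps / 2] turns this factor into [e^(2 eps delta)],
    at most [2] by admissibility. *)
Lemma hamenstadt_rho_quasi (x z u y : punctured_boundary xi) (M : R) :
  rho x z <= M -> rho z u <= M -> rho u y <= M -> rho x y <= 2 * M.
Proof.
set d := fun p q => mdist (val (f p)) (val (f q)).
have E1 : 1 <= expR (2 * delta) by rewrite -expR0 ler_expR mulr_ge0.
have Eeps : (expR (2 * delta) * expR (2 * delta)) `^ (eps / 2) <= 2.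
  rewrite -expRD -expRM; case: adm => _; apply: le_trans; rewrite ler_expR.
  by have := mulr_ge0 (ltW eps0) delta_ge0; lra.
have step p q v : d p q <= expR (2 * delta) * d p v \/
    d p q <= expR (2 * delta) * d v q.
  exact: boundary_mdist_le_of_hyperbolic.
have E0 := expR_ge0 (2 * delta).
have [m [mM] xym] : exists m, [/\ (m = d x z \/ m = d z u) \/ m = d u y &
    d x y <= expR (2 * delta) * expR (2 * delta) * m].
  have [xz|zy] := step x y z.
    exists (d x z); split; first by left; left.
    by rewrite (le_trans xz)// ler_wpM2r ?mdist_ge0// ler_peMr.
  have [zu|uy] := step z y u; [exists (d z u)|exists (d u y)].
    split; first by left; right.
    by rewrite (le_trans zy)// -mulrA ler_wpM2l.
  split; first by right.
  by rewrite (le_trans zy)// -mulrA ler_wpM2l.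
have m0 : 0 <= m by case: mM => [[]|] ->; exact: mdist_ge0.
rewrite !rhoE => h1 h2 h3.
have mM' : (m / D w) `^ (eps / 2) <= M by case: mM => [[]|] ->.
have mw0 : 0 <= m / D w by rewrite divr_ge0// ltW.
apply: (@le_trans _ _
    ((expR (2 * delta) * expR (2 * delta) * (m / D w)) `^ (eps / 2))).
  have Dw : 0 <= D w by exact/ltW.
  apply: ge0_ler_powR; rewrite ?nnegrE.
  - by rewrite divr_ge0// ltW.
  - by rewrite divr_ge0// mdist_ge0.
  - exact: mulr_ge0 (mulr_ge0 E0 E0) mw0.
  - by rewrite mulrA ler_wpM2r// invr_ge0.
rewrite (powRM _ (mulr_ge0 E0 E0) mw0).
by apply: ler_pM => //; exact: powR_ge0.
Qed.

Lemma hamenstadt_le_rho y z : hamenstadt b eps y z <= rho y z.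
Proof.
apply: ge_inf.
  by exists 0 => _ [n [zeta [_ _ _ ->]]]; apply: sumr_ge0 => i _;
    exact: hamenstadt_rho_ge0.
exists 1%N, (fun i => if i is 0%N then y else z); split=> //.
by rewrite big_ord1.
Qed.

Lemma rho_le_hamenstadt y z : rho y z <= 2 * hamenstadt b eps y z.
Proof.
rewrite mulrC -ler_pdivrMr//; apply: lb_le_inf.
  exists (rho y z), 1%N, (fun i => if i is 0%N then y else z); split=> //.
  by rewrite big_ord1.
move=> _ [n [zeta [_ <- <- ->]]]; rewrite ler_pdivrMr// mulrC.
apply: (@chain_ge _ _ rho); first exact: hamenstadt_rho_ge0.
  by move=> x; rewrite rhoE mdistxx mul0r powR0// gt_eqF// divr_gt0.
exact: hamenstadt_rho_quasi.
Qed.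

(** The power [2 / eps] recovers [mdist p q / D w] from [rho], and [D w] cancels, so the bound is
    the same for every base point. The factor [2] is lost in comparing [rho] with the Hamenstaedt
    metric. *)
Lemma hamenstadt_quasisymmetric :
  quasisymmetric (quasisymmetry_bound eps) (hamenstadt b eps)
    (fun p q : metric_boundary C => mdist (val p) (val q)) f.
Proof.
have Dw := D_gt0 w; have Dw' : 0 <= (D w)^-1 by rewrite invr_ge0 ltW.
have a0 : 0 < eps / 2 by rewrite divr_gt0.
have ab : eps / 2 * (2 / eps) = 1 by field; rewrite gt_eqF.
have dw0 y z : 0 <= mdist (val (f y)) (val (f z)) / D w.
  by rewrite mulr_ge0 ?mdist_ge0.
split; first split.
- move=> x e e0; exists ((e / D w) `^ (eps / 2) / 2).
    by rewrite divr_gt0// powR_gt0// divr_gt0.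
  move=> y; rewrite ltr_pdivlMr// mulrC => /(le_lt_trans (rho_le_hamenstadt _ _)).
  rewrite rhoE; apply: contraTT; rewrite -!leNgt => ed.
  apply: ge0_ler_powR; rewrite ?nnegrE ?dw0 ?(ltW a0)//.
    by rewrite divr_ge0// ltW.
  by rewrite ler_pM2r ?invr_gt0.
- have [g fK gK] := punctured_boundary_bijective; exists g; split=> // p e e0.
  exists (D w * e `^ (2 / eps)); first by rewrite mulr_gt0// powR_gt0.
  move=> q pq; apply: le_lt_trans (hamenstadt_le_rho _ _) _.
  have -> : e = (e `^ (2 / eps)) `^ (eps / 2).
    by rewrite -powRrM mulrC ab powRr1// ltW.
  rewrite rhoE !gK.
  apply: gt0_ltr_powR; rewrite ?nnegrE ?powR_ge0 ?mulr_ge0 ?mdist_ge0//.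
  by rewrite ltr_pdivrMr// mulrC.
move=> t x y z t0 xyz.
have h : rho x y <= 2 * t * rho x z.
  apply: le_trans (rho_le_hamenstadt _ _) _; rewrite -mulrA ler_pM2l//.
  by apply: le_trans xyz _; rewrite ler_pM2l// hamenstadt_le_rho.
rewrite !rhoE in h; have t2 : 0 <= 2 * t by rewrite mulr_ge0// ltW.
have : ((mdist (val (f x)) (val (f y)) / D w) `^ (eps / 2)) `^ (2 / eps) <=
    (2 * t * (mdist (val (f x)) (val (f z)) / D w) `^ (eps / 2)) `^ (2 / eps).
  apply: ge0_ler_powR; rewrite ?nnegrE ?powR_ge0//; first by rewrite divr_ge0// ltW.
  by rewrite mulr_ge0 ?powR_ge0.
rewrite powRM ?powR_ge0// -!powRrM ab !powRr1// (powRM _ _ (ltW t0))//.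
by rewrite mulrA ler_pM2r ?invr_gt0.
Qed.

End HamenstadtQuasisymmetry.

Theorem theorem1p3 (R : realType) :
  exists eta : R -> R -> R,
    (forall eps : R, 0 < eps -> homeomorphism_Rge0 (eta eps)) /\
    forall (X : metricType R) (C : completion X)
      (unbounded : ~ metric_bounded [set: X])
      (lc : locally_complete X) (inc : metric_boundary C !=set0),
    let Xj : metricType R := jtilde_space lc inc in
    gromov_hyperbolic Xj /\
    exists (phi : gromov_boundary Xj -> option (metric_boundary C))
      (xi : gromov_boundary Xj)
      (f : punctured_boundary xi -> metric_boundary C),
      [/\ natural_map (fun x : Xj => x : X) phi,
          phi xi = None,
          forall zeta : punctured_boundary xi, phi (val zeta) = Some (f zeta) &
          forall (delta eps : R) (b : Xj -> R),
            hyperbolic Xj delta -> admissible delta eps ->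
            busemann_functions xi b ->
            quasisymmetric (eta eps) (hamenstadt b eps)
              (fun p q : metric_boundary C => mdist (val p) (val q)) f].
Proof.
exists quasisymmetry_bound; split; first exact: quasisymmetry_bound_homeomorphism.
move=> X C unbounded lc inc Xj; split; first exact: jtilde_gromov_hyperbolic.
have [xi xiE] := gromov_boundary_infinity lc inc unbounded.
have [p0 p0b] := inc.
pose phi := @jtilde_boundary_map R X C lc inc.
(* The default in [odflt] makes [f] total; [phiE] shows that on the punctured boundary its value is
   always the one given by [phi]. *)
pose f (z : punctured_boundary xi) : metric_boundary C :=
  odflt (SigSub (mem_set p0b)) (phi (val z)).
have phi_xi : phi xi = None.
  have := jtilde_boundary_mapP xi; rewrite -/phi; case: (phi xi) => // p xip.
  have [u up] := seq_to_point_neq0 (val p).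
  by case: (seq_to_point_infinity lc inc up); rewrite -xiE xip.
have phiE z : phi (val z) = Some (f z).
  have := jtilde_boundary_mapP (val z); rewrite -/phi /f; case: (phi (val z)) => //.
  by move=> zE; case: (set_valP z); apply: val_inj; rewrite xiE zE.
have fE z : val (val z) = seq_to_point (val (f z)).
  by have := jtilde_boundary_mapP (val z); rewrite -/phi phiE.
exists phi, xi, f; split=> //; first exact: jtilde_boundary_map_natural.
move=> delta eps b hyp adm [w _ <-].
exact: hamenstadt_quasisymmetric hyp adm.
Qed.
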